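(* Let $\prec$ be an arbitrary term order and let $I\subseteq P=\Bbbk[x_1,\dots,x_n]$ be an ideal. If the field $\Bbbk$ is sufficiently large (every infinite field is; if $\Bbbk$ is finite, this means after replacing, if necessary, $\Bbbk$ by a sufficiently large finite extension field $K$ and $I$ by the ideal it generates in $K[x_1,\dots,x_n]$), then $I$ possesses a finite Pommaret basis for $\prec$ in suitably chosen variables, i.e. there is a regular matrix $A$ over the ground field such that, after the linear change of variables $\tilde{\mathbf{x}}=A\mathbf{x}$, the transformed ideal has a finite Pommaret basis for $\prec$.
   Context: A term order is a total order on $\mathbb{N}_0^n$ (identified with the terms $x^\mu$) with minimum $0$ that is compatible with addition. Term orders are defined on exponent vectors: after a linear change of variables $\tilde{\mathbf{x}}=A\mathbf{x}$ each polynomial is rewritten as a polynomial in $\tilde x_1,\dots,\tilde x_n$ and its new exponent vectors are sorted by the same order $\prec$. $\mathrm{le}_\prec f$ denotes the leading exponent of $f\ne0$ and $\mathrm{le}_\prec I=\{\mathrm{le}_\prec f\mid 0\neq f\in I\}$. The class of $\mu\in\mathbb{N}_0^n$ is $\mathrm{cls}\,\mu=\min\{i\mid\mu_i\ne0\}$, with $\mathrm{cls}\,0=n$. The Pommaret cone of $\mu$ is $C_P(\mu)=\{\mu+\rho\mid\rho\in\mathbb{N}_0^n,\ \rho_j=0\text{ for all }j>\mathrm{cls}\,\mu\}$. A finite Pommaret basis of $I$ for $\prec$ is a finite set $H\subset I\setminus\{0\}$ with pairwise distinct leading exponents such that $\mathrm{le}_\prec I$ is the disjoint union of the cones $C_P(\mathrm{le}_\prec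 h)$, $h\in H$.
   Formalization: The term order is assumed to satisfy x_1 ≺ x_2 ≺ … ≺ x_n, the numbering that goes with the definition of class; without it the claim fails, e.g. n = 2, lexicographic order with x_2 ≺ x_1, I = (x_1x_2). *)

(* Defs.v *)
From HB Require Import structures.
From mathcomp Require Import all_boot all_order all_algebra all_field.
From mathcomp Require Import mpoly.

Set Implicit Arguments.
Unset Strict Implicit.
Unset Printing Implicit Defensive.

Import GRing.Theory.
Local Open Scope ring_scope.

(* [prec] is the non-strict relation. *)
Record term_order (n : nat) (prec : rel 'X_{1..n}) : Prop := TermOrder {
  to_refl  : reflexive prec;
  to_anti  : antisymmetric prec;
  to_trans : transitive prec;
  to_total : total prec;
  to_min   : forall m, prec 0%MM m;
  to_add   : forall m m1 m2, prec m1 m2 -> prec (m + m1)%MM (m + m2)%MM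
}.

(* x_1 < ... < x_n, the numbering of the variables that goes with the
   definition of [cls] below.  It is not implied by [term_order], and a finite
   Pommaret basis need not exist in any variables without it: let n = 2, let
   the order be lexicographic with x_2 < x_1 and let I = (x_1 x_2).  After any
   regular change of variables I is generated by l_1 l_2 with l_1, l_2
   independent linear forms, so that every leading exponent has a positive
   first entry, hence class 1, and its cone has a constant second entry;
   finitely many such cones never contain all leading exponents. *)
Definition increasing_vars (n : nat) (prec : rel 'X_{1..n}) : Prop :=
  forall i j : 'I_n, (i < j)%N -> prec U_(i)%MM U_(j)%MM.

Definition mnm_max (n : nat) (prec : rel 'X_{1..n}) (m1 m2 : 'X_{1..n}) :=
  if prec m1 m2 then m2 else m1.

(* The largest element of the support; since 0 is the minimum of a term order,
   it is a neutral element for [mnm_max].  The value at 0 is irrelevant. *)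
Definition lexpo (n : nat) (prec : rel 'X_{1..n}) (R : fieldType)
    (f : {mpoly R[n]}) : 'X_{1..n} :=
  \big[mnm_max prec/0%MM]_(m <- msupp f) m.

Definition lexpo_set (n : nat) (prec : rel 'X_{1..n}) (R : fieldType)
    (I : {mpoly R[n]} -> Prop) (m : 'X_{1..n}) : Prop :=
  exists f, [/\ I f, f != 0 & lexpo prec f = m].

(* Ordinals start at 0 whereas the variables are numbered from 1, so the
   ordinal [i] stands for the variable number [i.+1].  The minimum over the
   empty range is the default value [n], which gives cls 0 = n. *)
Definition cls (n : nat) (m : 'X_{1..n}) : nat :=
  \big[minn/n]_(i < n | m i != 0%N) i.+1.

Definition pommaret_cone (n : nat) (m m' : 'X_{1..n}) : Prop :=
  exists2 r : 'X_{1..n},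
    (forall j : 'I_n, (cls m < j.+1)%N -> r j = 0%N) & m' = (m + r)%MM.

Definition is_ideal (n : nat) (R : fieldType) (I : {mpoly R[n]} -> Prop) :
    Prop :=
  [/\ I 0, forall f g, I f -> I g -> I (f + g)
    & forall f g, I g -> I (f * g)].

Definition pommaret_basis (n : nat) (prec : rel 'X_{1..n}) (R : fieldType)
    (I : {mpoly R[n]} -> Prop) (H : seq {mpoly R[n]}) : Prop :=
  [/\ forall h, h \in H -> I h /\ h != 0,
      {in H &, injective (lexpo prec (R := R))},
      forall m, lexpo_set prec I m <->
        exists2 h, h \in H & pommaret_cone (lexpo prec h) m
    & forall h1 h2 m, h1 \in H -> h2 \in H ->
        pommaret_cone (lexpo prec h1) m -> pommaret_cone (lexpo prec h2) m ->
        h1 = h2].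

(* With x~ = A x, the variable x_i is the i-th entry of A^-1 x~. *)
Definition change_vars (n : nat) (R : fieldType) (A : 'M[R]_n)
    (f : {mpoly R[n]}) : {mpoly R[n]} :=
  f \mPo [tuple \sum_(j < n) invmx A i j *: 'X_j | i < n].

Definition change_vars_ideal (n : nat) (R : fieldType) (A : 'M[R]_n)
    (I : {mpoly R[n]} -> Prop) (g : {mpoly R[n]}) : Prop :=
  exists2 f, I f & g = change_vars A f.

Definition pommaret_in_suitable_vars (n : nat) (prec : rel 'X_{1..n})
    (R : fieldType) (I : {mpoly R[n]} -> Prop) : Prop :=
  exists2 A : 'M[R]_n, A \in unitmx
    & exists H : seq {mpoly R[n]},
        pommaret_basis prec (change_vars_ideal A I) H.

(* The ideal of K[x_1,...,x_n] generated by I. *)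
Definition extend_ideal (n : nat) (k : fieldType) (K : fieldExtType k)
    (I : {mpoly k[n]} -> Prop) (g : {mpoly K[n]}) : Prop :=
  forall J : {mpoly K[n]} -> Prop, is_ideal J ->
    (forall f, I f -> J (map_mpoly (in_alg K) f)) -> J g.

Definition finite_field (k : fieldType) : Prop :=
  exists s : seq k, forall x, x \in s.

Definition has_at_least (N : nat) (k : fieldType) : Prop :=
  exists2 s : seq k, uniq s & (N <= size s)%N.

(* Main.v *)
(* Let X be the matrix of indeterminates over R = k[t_ij] and let U be the set
   of leading exponents of the R-span of the polynomials f(X x), f in I.

   U is quasi-stable: it contains, with x^m and for i < j, the term obtained
   from x^m by replacing every x_i by x_j.  Let J be spanned by finitely many
   f(X x), let M be its leading exponents and let d be the term obtained from
   some m in M.  If d is not in M, replace X by X T g, with T a diagonal matrix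
   of further indeterminates and g : x_i -> x_i + x_j; this cannot increase
   ranks modulo the span of the terms below d.  So the images of the elements of
   J that lead at m and at the elements of M above d become dependent.  The
   top coefficient of the relation in the indeterminates of T is a relation
   between the images under g of the leading terms alone, and those are
   independent, since g x^m has the new term x^d and g is triangular.

   U is also the set of leading exponents after every substitution B over a
   field K for which det X and the leading coefficients of finitely many
   generators do not vanish: reduction modulo the generators is defined
   over R localised at these elements, so it commutes with X -> B, and it
   kills the specialised ideal because it kills the generic one.  Such a B
   exists as soon as K has more elements than the degree of one polynomial.

   Finally a quasi-stable upward closed set is a finite disjoint union of
   Pommaret cones. *)

From HB Require Import structures.
Require Import Defs.
From mathcomp Require Import all_boot all_order all_algebra all_field.
From mathcomp Require Import mpoly.
From mathcomp Require Import zify.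
From Stdlib Require Import Classical.

Set Implicit Arguments.
Unset Strict Implicit.
Unset Printing Implicit Defensive.

Import GRing.Theory.
Local Open Scope ring_scope.

(** * Compatible total orders and leading exponents *)

(** Unlike [term_order], this notion passes to the reversed relation, so that lowest terms can be
    treated as leading terms. *)
Record monomial_order (n : nat) (prec : rel 'X_{1..n}) : Prop := MonomialOrder {
  mo_anti  : antisymmetric prec;
  mo_trans : transitive prec;
  mo_total : total prec;
  mo_add   : forall m m1 m2, prec m1 m2 -> prec (m + m1)%MM (m + m2)%MM
}.

Section MonomialOrder.
Variables (n : nat) (prec : rel 'X_{1..n}).

Lemma term_order_monomial : term_order prec -> monomial_order prec.
Proof. by case=> _ ? ? ? _ ?; split. Qed.

Hypothesis ord : monomial_order prec.

Lemma monomial_order_rev : monomial_order (fun u v => prec v u).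
Proof.
case: ord => anti trans tot add; split.
- by move=> u v uv; apply: anti; rewrite andbC.
- by move=> v u w uv vw; apply: trans vw uv.
- by move=> u v; apply: tot.
- by move=> m u v; apply: add.
Qed.

Lemma monomial_order_refl m : prec m m.
Proof. by have := mo_total ord m m; rewrite orbb. Qed.

Lemma monomial_order_eq u v : prec u v -> prec v u -> u = v.
Proof. by move=> uv vu; apply: (mo_anti ord); rewrite uv vu. Qed.

Lemma monomial_order_addr m u v : prec u v -> prec (u + m)%MM (v + m)%MM.
Proof. by rewrite ![(_ + m)%MM]addmC; apply: mo_add. Qed.

Lemma monomial_order_add u1 u2 v1 v2 :
  prec u1 u2 -> prec v1 v2 -> prec (u1 + v1)%MM (u2 + v2)%MM.
Proof.
move=> u12 v12; apply: (mo_trans ord (y := (u2 + v1)%MM)).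
  exact: monomial_order_addr.
exact: mo_add.
Qed.

(** Cancellation: the top exponent of a product arises only from the two top exponents of the
    factors, which gives [mcoeff_mul_bounded]. *)
Lemma monomial_order_add_eq u1 u2 v1 v2 :
  prec u1 u2 -> prec v1 v2 ->
  (u1 + v1 == u2 + v2)%MM = (u1 == u2) && (v1 == v2).
Proof.
move=> u12 v12; apply/eqP/andP=> [e|[/eqP-> /eqP->] //].
have v2e : (u1 + v2 = u2 + v2)%MM.
  apply: monomial_order_eq; first exact: monomial_order_addr.
  by rewrite -e; apply: mo_add.
by move: e; move/addIm: v2e => ->; move/addmI->.
Qed.

Definition supp_bounded (R : nzRingType) (u : 'X_{1..n}) (p : {mpoly R[n]}) :=
  forall m, m \in msupp p -> prec m u.

Lemma mcoeff_sum_msupp (R : nzRingType) (p : {mpoly R[n]}) u :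
  \sum_(m <- msupp p) p@_m * (m == u)%:R = p@_u.
Proof.
rewrite [in RHS](mpolyE p) raddf_sum /=.
by apply: eq_bigr => m _; rewrite mcoeffZ mcoeffX.
Qed.

Lemma supp_bounded_mul (R : nzRingType) u v (p q : {mpoly R[n]}) :
  supp_bounded u p -> supp_bounded v q -> supp_bounded (u + v)%MM (p * q).
Proof.
move=> pu qv m /msuppM_le /allpairsP[[m1 m2] /= [/pu m1u /qv m2v ->]].
exact: monomial_order_add.
Qed.

Lemma mcoeff_mul_bounded (R : nzRingType) u v (p q : {mpoly R[n]}) :
  supp_bounded u p -> supp_bounded v q -> (p * q)@_(u + v) = p@_u * q@_v.
Proof.
move=> pu qv; rewrite mpolyME raddf_sum /= big_allpairs_dep /=.
rewrite -(mcoeff_sum_msupp p u) mulr_suml; apply: eq_big_seq => m1 /pu m1u.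
rewrite -(mcoeff_sum_msupp q v) mulr_sumr; apply: eq_big_seq => m2 /qv m2v.
rewrite mcoeffZ mcoeffX monomial_order_add_eq // -mulnb natrM.
by rewrite !mulrA -(mulrA p@_m1) -[(m1 == u)%:R * _]commr_nat !mulrA.
Qed.

Lemma supp_bounded_trans (R : nzRingType) u v (p : {mpoly R[n]}) :
  prec u v -> supp_bounded u p -> supp_bounded v p.
Proof. by move=> uv pu m /pu mu; apply: (mo_trans ord) uv. Qed.

Lemma mcoeff_supp_bounded (R : nzRingType) u v (p : {mpoly R[n]}) :
  supp_bounded u p -> prec u v -> v != u -> p@_v = 0.
Proof.
move=> pu uv; apply: contraNeq; rewrite -mcoeff_msupp => /pu vu.
by apply/eqP; apply: monomial_order_eq.
Qed.

Lemma supp_boundedD (R : nzRingType) u (p q : {mpoly R[n]}) :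
  supp_bounded u p -> supp_bounded u q -> supp_bounded u (p + q).
Proof.
by move=> pu qu m /msuppD_le; rewrite mem_cat => /orP[/pu|/qu].
Qed.

Lemma supp_bounded_sum (R : nzRingType) (T : eqType) (r : seq T)
    (F : T -> {mpoly R[n]}) u :
  (forall t, t \in r -> supp_bounded u (F t)) ->
  supp_bounded u (\sum_(t <- r) F t).
Proof.
elim: r => [|t r IH] Fu; first by move=> m; rewrite big_nil msupp0.
rewrite big_cons; apply: supp_boundedD; first by apply: Fu; rewrite mem_head.
by apply: IH => t' rt'; apply: Fu; rewrite in_cons rt' orbT.
Qed.

Lemma supp_boundedZ (R : nzRingType) c u (p : {mpoly R[n]}) :
  supp_bounded u p -> supp_bounded u (c *: p).
Proof. by move=> pu m /msuppZ_le /pu. Qed.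

Lemma supp_boundedX (R : nzRingType) u : supp_bounded u ('X_[u] : {mpoly R[n]}).
Proof. by move=> m; rewrite msuppX inE => /eqP->; apply: monomial_order_refl. Qed.

Lemma prec_max_exists (s : seq 'X_{1..n}) : s != [::] ->
  exists2 u, u \in s & forall m, m \in s -> prec m u.
Proof.
elim: s => [//|u [|v s] IH] _.
  exists u; first exact: mem_head.
  by move=> m; rewrite inE => /eqP->; apply: monomial_order_refl.
have [w ws max_w] := IH isT.
case/orP: (mo_total ord u w) => [uw|wu].
  exists w; first by rewrite in_cons ws orbT.
  by move=> m; rewrite in_cons => /orP[/eqP->|/max_w].
exists u; first exact: mem_head.
move=> m; rewrite in_cons => /orP[/eqP->|/max_w mw].
  exact: monomial_order_refl.
exact: (mo_trans ord) wu.
Qed.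

(** A relation instead of a function such as [lexpo]: it makes sense for reversed orders and over
    rings, and it holds for no exponent at the zero polynomial. *)
Definition lead (R : nzRingType) (u : 'X_{1..n}) (p : {mpoly R[n]}) :=
  p@_u != 0 /\ supp_bounded u p.

Lemma lead_exists (R : nzRingType) (p : {mpoly R[n]}) :
  p != 0 -> exists u, lead u p.
Proof.
rewrite -msupp_eq0 => /prec_max_exists[u up max_u].
by exists u; split=> //; rewrite -mcoeff_msupp.
Qed.

Lemma lead_neq0 (R : nzRingType) u (p : {mpoly R[n]}) : lead u p -> p != 0.
Proof. by case=> pu _; apply: contraNneq pu => ->; rewrite mcoeff0. Qed.

Lemma lead_uniq (R : nzRingType) u v (p : {mpoly R[n]}) :
  lead u p -> lead v p -> u = v.
Proof.
rewrite /lead -!mcoeff_msupp => -[up pu] [vp pv].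
by apply: monomial_order_eq; [apply: pv|apply: pu].
Qed.

Lemma lead_mul (R : idomainType) u v (p q : {mpoly R[n]}) :
  lead u p -> lead v q -> lead (u + v)%MM (p * q).
Proof.
move=> [pu up] [qv vq]; split; last exact: supp_bounded_mul.
by rewrite mcoeff_mul_bounded // mulf_neq0.
Qed.

Lemma lead_scale (R : idomainType) c u (p : {mpoly R[n]}) :
  c != 0 -> lead u p -> lead u (c *: p).
Proof.
move=> c0 [pu up]; split; last exact: supp_boundedZ.
by rewrite mcoeffZ mulf_neq0.
Qed.

Lemma leadX (R : nzRingType) u : lead u ('X_[u] : {mpoly R[n]}).
Proof. by split; [rewrite mcoeffX eqxx oner_neq0|apply: supp_boundedX]. Qed.

End MonomialOrder.

(** * Leading exponents for term orders *)

Section TermOrder.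
Variables (n : nat) (prec : rel 'X_{1..n}).
Hypothesis prec_to : term_order prec.
Let ord := term_order_monomial prec_to.

Lemma term_order_dvd u v : (u <= v)%MM -> prec u v.
Proof.
move=> uv; rewrite -(submK uv) addmC -{1}(addm0 u).
exact/(to_add prec_to)/(to_min prec_to).
Qed.

Lemma lexpo_lead (R : fieldType) (f : {mpoly R[n]}) :
  f != 0 -> lead prec (lexpo prec f) f.
Proof.
rewrite -msupp_eq0 /lead -mcoeff_msupp /supp_bounded /lexpo.
elim: (msupp f) => [//|u s IH] _.
case: (eqVneq s [::]) => [->|/IH[inw maxw]].
  rewrite big_cons big_nil /mnm_max; case: ifP => u0.
    (* The initial value 0 of the fold wins only against 0 itself, so the result lies in the
       support. *)
    have -> : u = 0%MM by apply: (monomial_order_eq ord) => //; apply: to_min.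
    by split=> [|m]; rewrite inE // => /eqP->; apply: to_refl.
  by split=> [|m]; rewrite inE // => /eqP->; apply: to_refl.
rewrite big_cons; move: inw maxw; set w := \big[_/_]_(_ <- s) _ => inw maxw.
rewrite /mnm_max; case: ifP => uw; split.
- by rewrite in_cons inw orbT.
- by move=> m; rewrite in_cons => /orP[/eqP->|/maxw].
- exact: mem_head.
- have wu : prec w u by have := to_total prec_to u w; rewrite uw.
  move=> m; rewrite in_cons => /orP[/eqP->|/maxw mw]; first exact: to_refl.
  exact: to_trans wu.
Qed.

Lemma lexpo_setP (R : fieldType) (I : {mpoly R[n]} -> Prop) m :
  lexpo_set prec I m <-> exists2 f, I f & lead prec m f.
Proof.
split=> [[f [If f0 <-]]|[f If fm]]; first by exists f => //; apply: lexpo_lead.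
have f0 := lead_neq0 fm; exists f; split=> //.
exact: (lead_uniq ord (lexpo_lead f0)).
Qed.

End TermOrder.

(** * Dickson's lemma and induction along a term order *)

(** [Q] is an arbitrary proposition, so excluded middle takes the place of [filter]. *)
Lemma seq_subset_exists (T : eqType) (s : seq T) (Q : T -> Prop) :
  exists2 s' : seq T, uniq s' & forall x, x \in s' <-> x \in s /\ Q x.
Proof.
elim: s => [|x s [s' us' s'P]]; first by exists [::] => // x; split=> [|[]].
have [Qx|nQx] := classic (Q x); last first.
  exists s' => // y; rewrite s'P in_cons; split=> [[-> ]|]; first by rewrite orbT.
  by case=> /orP[/eqP->|].
case: (boolP (x \in s')) => xs'.
  exists s' => // y; rewrite s'P in_cons; split=> [[-> ]|]; first by rewrite orbT.
  by case=> /orP[/eqP->|//] _; apply/s'P.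
exists (x :: s') => [|y]; first by rewrite /= xs'.
rewrite !in_cons; split=> [/orP[/eqP->|/s'P[-> ?]]|[/orP[->//|ys Qy]]].
- by rewrite eqxx.
- by rewrite orbT.
- by apply/orP; right; apply/s'P.
Qed.

(* Induction on the number of coordinates that are compared. *)
Lemma dickson_coords (n : nat) (j : nat) (U : 'X_{1..n} -> Prop) :
  exists2 s : seq 'X_{1..n}, (forall u, u \in s -> U u) &
    forall v, U v -> exists2 u, u \in s & forall i : 'I_n, (i < j)%N -> (u i <= v i)%N.
Proof.
elim: j U => [|j IH] U.
  have [[v Uv]|nU] := classic (exists v, U v).
    by exists [:: v] => [u|w _]; [rewrite inE => /eqP->|exists v; rewrite ?inE].
  by exists [::] => // v Uv; case: nU; exists v.
have [jn|nj] := ltnP j n; last first.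
  have [s sU sP] := IH U; exists s => // v /sP[u us uv]; exists u => // i _.
  by apply: uv; apply: leq_trans nj.
pose c := Ordinal jn; have [s sU sP] := IH U.
(* Elements whose coordinate [c] is at least the maximum over [s] are covered by [s]; the others lie
   in finitely many slices of constant coordinate, each covered by induction. *)
have slices N : exists2 t : seq 'X_{1..n}, (forall u, u \in t -> U u) &
    forall v, U v -> (v c < N)%N ->
      exists2 u, u \in t & forall i : 'I_n, (i < j.+1)%N -> (u i <= v i)%N.
  elim: N => [|N [t tU tP]]; first by exists [::].
  have [t' t'U t'P] := IH (fun v => U v /\ v c = N).
  exists (t ++ t') => [u|v Uv].
    by rewrite mem_cat => /orP[/tU|/t'U[]].
  rewrite ltnS leq_eqVlt => /orP[/eqP vN|vN].
    have [|u ut' uv] := t'P v; first by [].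
    exists u; first by rewrite mem_cat ut' orbT.
    move=> i; rewrite ltnS leq_eqVlt => /orP[/eqP ij|/uv //].
    have -> : i = c by apply: val_inj.
    by have [_ ->] := t'U _ ut'; rewrite vN.
  have [u ut uv] := tP v Uv vN; exists u => //.
  by rewrite mem_cat ut.
have [t tU tP] := slices (\max_(u <- s) u c)%N.
exists (s ++ t) => [u|v Uv]; first by rewrite mem_cat => /orP[/sU|/tU].
have [vN|Nv] := ltnP (v c) (\max_(u <- s) u c)%N.
  have [u ut uv] := tP v Uv vN; exists u => //.
  by rewrite mem_cat ut orbT.
have [u us uv] := sP v Uv; exists u; first by rewrite mem_cat us.
move=> i; rewrite ltnS leq_eqVlt => /orP[/eqP ij|/uv //].
have -> : i = c by apply: val_inj.
by apply: leq_trans Nv; rewrite (big_rem u us) leq_maxl.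
Qed.

Lemma dickson (n : nat) (U : 'X_{1..n} -> Prop) :
  exists2 s : seq 'X_{1..n}, (forall u, u \in s -> U u) &
    forall v, U v -> exists2 u, u \in s & (u <= v)%MM.
Proof.
have [s sU sP] := dickson_coords n U; exists s => // v /sP[u us uv].
by exists u => //; apply/mnm_lepP => i; apply: uv.
Qed.

(** By Dickson's lemma finitely many counterexamples divide all others. The least of these for
    [prec] is a least counterexample, as divisors are smaller. *)
Lemma term_order_ind (n : nat) (prec : rel 'X_{1..n}) (Q : 'X_{1..n} -> Prop) :
  term_order prec ->
  (forall v, (forall u, prec u v -> u != v -> Q u) -> Q v) -> forall v, Q v.
Proof.
move=> to step v; apply: NNPP => nQv.
have [s sQ sP] := dickson (fun u => ~ Q u).
have [|u us min_u] := prec_max_exists (monomial_order_rev (term_order_monomial to))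
  (s := s).
  by have [w] := sP v nQv; case: (s).
apply: (sQ _ us); apply: step => w wu neq; apply: NNPP => nQw.
have [x xs xw] := sP w nQw.
move/eqP: neq; apply; apply: (mo_anti (term_order_monomial to)).
by rewrite wu (to_trans to (min_u _ xs)) // term_order_dvd.
Qed.

(** * Linear substitutions *)

Lemma mpoly_rmorph_ext (n : nat) (R : nzRingType) (S : nzRingType)
    (f g : {rmorphism {mpoly R[n]} -> S}) :
  (forall c, f c%:MP = g c%:MP) -> (forall i, f 'X_i = g 'X_i) -> f =1 g.
Proof.
move=> fgC fgX p; rewrite (mpolyE p) !raddf_sum; apply: eq_bigr => m _ /=.
rewrite -mul_mpolyC !rmorphM /= fgC mpolyXE_id !rmorph_prod /=; congr (_ * _).
by apply: eq_bigr => i _; rewrite !rmorphXn /= fgX.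
Qed.

Section LinearSubstitution.
Variables (n : nat) (R : comNzRingType).
Implicit Types (A B C : 'M[R]_n).

(** The substitution of [change_vars] with the matrix itself instead of its inverse, over a
    commutative ring, so that entries may be indeterminates. *)
Definition lin_sub B (f : {mpoly R[n]}) : {mpoly R[n]} :=
  f \mPo [tuple \sum_(j < n) B i j *: 'X_j | i < n].

HB.instance Definition _ B := GRing.LRMorphism.copy (lin_sub B)
  (comp_mpoly [tuple \sum_(j < n) B i j *: 'X_j | i < n]).

Lemma lin_subC B c : lin_sub B c%:MP = c%:MP.
Proof. exact: comp_mpolyC. Qed.

Lemma lin_subZ B c f : lin_sub B (c *: f) = c *: lin_sub B f.
Proof. exact: comp_mpolyZ. Qed.

Lemma lin_subX B i : lin_sub B 'X_i = \sum_(j < n) B i j *: 'X_j.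
Proof. by rewrite /lin_sub comp_mpolyXU -tnth_nth tnth_mktuple. Qed.

Lemma lin_sub_comp B C f : lin_sub C (lin_sub B f) = lin_sub (B *m C) f.
Proof.
apply: (mpoly_rmorph_ext (f := lin_sub C \o lin_sub B) (g := lin_sub (B *m C))).
  by move=> c /=; rewrite !lin_subC.
move=> i /=; rewrite !lin_subX raddf_sum /=.
under eq_bigr => j _ do rewrite linearZ /= lin_subX scaler_sumr.
rewrite exchange_big; apply: eq_bigr => j _.
rewrite mxE scaler_suml; apply: eq_bigr => l _.
by rewrite scalerA.
Qed.

(** Cramer's rule: the adjugate replaces the inverse, at the price of a factor [\det B]. *)
Lemma det_scaleX B i :
  \det B *: 'X_i = \sum_(j < n) \adj B i j *: lin_sub B 'X_j.
Proof.
under eq_bigr => j _ do rewrite lin_subX scaler_sumr.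
rewrite exchange_big (bigD1 i) //= [X in _ + X]big1 ?addr0 => [|l li].
  under eq_bigr => j _ do rewrite scalerA.
  rewrite -scaler_suml; congr (_ *: _).
  by have /matrixP/(_ i i) := mul_adj_mx B; rewrite !mxE eqxx mulr1n => <-.
under eq_bigr => j _ do rewrite scalerA.
rewrite -scaler_suml.
have /matrixP/(_ i l) := mul_adj_mx B; rewrite !mxE.
by rewrite eq_sym (negPf li) mulr0n => ->; rewrite scale0r.
Qed.

Lemma lin_sub_diag (d : 'rV[R]_n) m :
  lin_sub (diag_mx d) 'X_[m] = (\prod_(i < n) d 0 i ^+ m i) *: 'X_[m].
Proof.
rewrite {1}mpolyXE_id rmorph_prod /=.
under eq_bigr => i _.
  rewrite rmorphXn /= lin_subX (bigD1 i) //= big1 ?addr0 => [|j ji]; last first.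
    by rewrite !mxE eq_sym (negPf ji) mulr0n scale0r.
  rewrite !mxE eqxx mulr1n -mul_mpolyC exprMn; over.
rewrite big_split /= -mpolyXE_id -mul_mpolyC rmorph_prod /=.
by under [in RHS]eq_bigr => i _ do rewrite rmorphXn.
Qed.

End LinearSubstitution.

Lemma map_lin_sub (n : nat) (R S : comNzRingType) (phi : {rmorphism R -> S})
    (B : 'M[R]_n) f :
  map_mpoly phi (lin_sub B f) = lin_sub (map_mx phi B) (map_mpoly phi f).
Proof.
apply: (mpoly_rmorph_ext (f := map_mpoly phi \o lin_sub B)
  (g := lin_sub (map_mx phi B) \o map_mpoly phi)) => [c|i] /=.
  by rewrite lin_subC !map_mpolyC lin_subC.
rewrite map_mpolyX !lin_subX raddf_sum /=.
by apply: eq_bigr => j _; rewrite map_mpolyZ map_mpolyX mxE.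
Qed.

Lemma change_varsE (n : nat) (R : fieldType) (A : 'M[R]_n) f :
  change_vars A f = lin_sub (invmx A) f.
Proof. by []. Qed.

Lemma map_mpolyK (n : nat) (R : nzRingType) (f : {mpoly R[n]}) :
  map_mpoly idfun f = f.
Proof. by apply/mpolyP => m; rewrite mcoeff_map_mpoly. Qed.

(** * Moves of exponents and transvections *)

Definition mnm_move (n : nat) (i j : 'I_n) (m : 'X_{1..n}) : 'X_{1..n} :=
  [multinom (if l == i then 0 else if l == j then m l + m i else m l)%N | l < n].

Section Transvection.
Variables (n : nat) (prec : rel 'X_{1..n}) (R : comNzRingType).
Hypothesis ord : monomial_order prec.
Variables i j : 'I_n.
Hypothesis prec_ij : prec U_(i)%MM U_(j)%MM.
Hypothesis neq_ij : i != j.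

Definition transvection : 'M[R]_n := 1%:M + delta_mx i j.

Lemma lin_sub_transvection l :
  lin_sub transvection 'X_l = if l == i then 'X_i + 'X_j else 'X_l.
Proof.
rewrite lin_subX.
have -> : \sum_(c < n) transvection l c *: 'X_c =
    'X_l + (l == i)%:R *: 'X_j :> {mpoly R[n]}.
  under eq_bigr => c _ do rewrite /transvection !mxE scalerDl.
  rewrite big_split /=; congr (_ + _).
    rewrite (bigD1 l) //= big1 ?addr0 => [|c cl]; first by rewrite eqxx scale1r.
    by rewrite eq_sym (negPf cl) scale0r.
  rewrite (bigD1 j) //= big1 ?addr0 => [|c cj]; first by rewrite eqxx andbT.
  by rewrite (negPf cj) andbF scale0r.
by case: eqP => [->|_]; rewrite ?scale1r // scale0r addr0.
Qed.

(** Stated for any order [o]: with [prec] it yields the largest term of a product of powers, with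
    the reversed order the smallest. *)
Lemma mcoeff_prod_bounded (o : rel 'X_{1..n}) (oo : monomial_order o)
    (p : 'I_n -> {mpoly R[n]}) (u : 'I_n -> 'X_{1..n}) (e : 'I_n -> nat) :
  (forall l, supp_bounded o (u l) (p l) /\ (p l)@_(u l) = 1) ->
  let v := (\sum_(l < n) u l *+ e l)%MM in
  supp_bounded o v (\prod_(l < n) p l ^+ e l) /\
  (\prod_(l < n) p l ^+ e l)@_v = 1.
Proof.
move=> pu /=; apply: (big_rec2 (fun v q => supp_bounded o v q /\ q@_v = 1)).
  by rewrite -mpolyX0 mcoeffX eqxx; split=> //; apply: supp_boundedX.
move=> l v q _ [vq qv].
have [ul1 ul2] : supp_bounded o (u l *+ e l)%MM (p l ^+ e l) /\
    (p l ^+ e l)@_(u l *+ e l) = 1.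
  elim: (e l) => [|d [IH1 IH2]].
    by rewrite mulm0n expr0 -mpolyX0 mcoeffX eqxx; split=> //; apply: supp_boundedX.
  rewrite mulmS exprS (mcoeff_mul_bounded oo) //; last by case: (pu l).
  rewrite IH2; case: (pu l) => ? ->; rewrite mulr1; split=> //.
  exact: supp_bounded_mul.
rewrite (mcoeff_mul_bounded oo) // ul2 qv mulr1; split=> //.
exact: supp_bounded_mul.
Qed.

Lemma lin_sub_transvectionX m :
  lin_sub transvection 'X_[m] =
  \prod_(l < n) (if l == i then 'X_i + 'X_j else 'X_l) ^+ m l.
Proof.
rewrite mpolyXE_id rmorph_prod; apply: eq_bigr => l _ /=.
by rewrite rmorphXn /= lin_sub_transvection.
Qed.

(** For the reversed order x_i leads x_i + x_j, so x^m is the lowest term of its image. With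
    [transvection_diag] the substitution is unitriangular. *)
Lemma transvection_ge m u : u \in msupp (lin_sub transvection 'X_[m]) -> prec m u.
Proof.
have rord := monomial_order_rev ord.
have := mcoeff_prod_bounded rord (p := fun l => if l == i then 'X_i + 'X_j else 'X_l)
  (u := fun l => U_(l)%MM) m.
rewrite -lin_sub_transvectionX -multinomUE_id => h.
move: u; case: h => // l; case: eqP => [->|_].
  split; last first.
    by rewrite mcoeffD !mcoeffX eqxx eq_mnm1 eq_sym (negPf neq_ij) addr0.
  apply: supp_boundedD; first exact: supp_boundedX.
  by move=> u; rewrite msuppX inE => /eqP->.
by split; [apply: supp_boundedX|rewrite mcoeffX eqxx].
Qed.

Lemma transvection_diag m : (lin_sub transvection 'X_[m])@_m = 1.
Proof.
have rord := monomial_order_rev ord.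
have := mcoeff_prod_bounded rord (p := fun l => if l == i then 'X_i + 'X_j else 'X_l)
  (u := fun l => U_(l)%MM) m.
rewrite -lin_sub_transvectionX -multinomUE_id => h.
case: h => // l; case: eqP => [->|_].
  split; last first.
    by rewrite mcoeffD !mcoeffX eqxx eq_mnm1 eq_sym (negPf neq_ij) addr0.
  apply: supp_boundedD; first exact: supp_boundedX.
  by move=> u; rewrite msuppX inE => /eqP->.
by split; [apply: supp_boundedX|rewrite mcoeffX eqxx].
Qed.

Lemma mnm_moveE m :
  mnm_move i j m = (\sum_(l < n) (if l == i then U_(j) else U_(l)) *+ m l)%MM.
Proof.
apply/mnmP => c; rewrite mnmE mnm_sumE.
rewrite (bigD1 i) //= eqxx mulmnE mnm1E.
under eq_bigr => l li do rewrite (negPf li) mulmnE mnm1E.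
case: (eqVneq c i) => [->|ci].
  rewrite eq_sym (negPf neq_ij) mul0n add0n big1 // => l li.
  by rewrite (negPf li) mul0n.
rewrite (bigD1 c) //= eqxx mul1n big1 ?addn0 => [|l /andP[_ lc]].
  by rewrite (eq_sym j); case: eqP => [_|_]; rewrite ?mul1n ?mul0n //= addnC.
by rewrite (negPf lc) mul0n.
Qed.

(** For [prec] itself x_j leads x_i + x_j, so the moved exponent is the top of the image, with
    coefficient 1 in every characteristic. *)
Lemma transvection_move m : (lin_sub transvection 'X_[m])@_(mnm_move i j m) = 1.
Proof.
have := mcoeff_prod_bounded ord (p := fun l => if l == i then 'X_i + 'X_j else 'X_l)
  (u := fun l => if l == i then U_(j)%MM else U_(l)%MM) m.
rewrite -lin_sub_transvectionX -mnm_moveE => h.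
case: h => // l; case: eqP => [_|_].
  split; last by rewrite mcoeffD !mcoeffX eqxx eq_mnm1 (negPf neq_ij) add0r.
  apply: supp_boundedD; last exact: supp_boundedX.
  by move=> u; rewrite msuppX inE => /eqP->.
by split; [apply: supp_boundedX|rewrite mcoeffX eqxx].
Qed.

End Transvection.

Lemma lin_sub_map_transvection (n : nat) (R S : comNzRingType)
    (phi : {rmorphism R -> S}) (i j : 'I_n) m :
  lin_sub (transvection S i j) 'X_[m] =
  map_mpoly phi (lin_sub (transvection R i j) 'X_[m]).
Proof.
rewrite map_lin_sub map_mpolyX; congr (lin_sub _ _).
by apply/matrixP => a b; rewrite !mxE rmorphD /= !rmorph_nat.
Qed.

(** * Ranks over the fraction field of a domain *)

Lemma rank_kermx_le (F : fieldType) m n r (A : 'M[F]_(m, n)) (C : 'M[F]_(m, r)) :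
  (kermx C <= kermx A)%MS -> (\rank A <= \rank C)%N.
Proof.
move=> le; have := mxrankS le; rewrite !mxrank_ker leq_sub2lE //.
exact: rank_leq_row.
Qed.

Section FractionMatrix.
Variable R : idomainType.
Local Notation "A ^F" := (map_mx (@FracField.tofrac R) A) (at level 2, format "A ^F").

Lemma fraction_numden (x : {fraction R}) :
  exists a d : R, d != 0 /\ FracField.tofrac a = FracField.tofrac d * x.
Proof.
elim/quotW: x => y; exists y.1, y.2; split; first exact: denom_ratioP.
rewrite -[RHS]/(FracField.mul _ _) !piE; apply/eqP; rewrite piE.
rewrite FracField.equivfE /FracField.mulf.
rewrite !numden_Ratio ?mulf_neq0 ?oner_eq0 ?denom_ratioP //.
by rewrite !mul1r mulrC.
Qed.

Lemma fraction_row_numden s (v : 'rV[{fraction R}]_s) :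
  exists (w : 'rV[R]_s) (d : R), d != 0 /\ w^F = FracField.tofrac d *: v.
Proof.
elim: s v => [|s IH] v.
  by exists 0, 1; rewrite oner_neq0; split=> //; apply/matrixP => i [].
have [a [d [d0 ad]]] := fraction_numden (v 0 ord0).
have [w [e [e0 we]]] := IH (\row_j v 0 (lift ord0 j)).
exists (\row_j if unlift ord0 j is Some c then d * w 0 c else e * a), (d * e).
split; first exact: mulf_neq0.
apply/rowP => j; rewrite !mxE rmorphM /=; case: unliftP => [c|] ->.
  have /rowP/(_ c) := we; rewrite !mxE -mulrA => <-.
  by rewrite rmorphM.
by rewrite rmorphM /= ad mulrA [_ * FracField.tofrac d]mulrC.
Qed.

Lemma map_tofrac_eq0 m n (A : 'M[R]_(m, n)) : A^F = 0 -> A = 0.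
Proof.
move=> /matrixP A0; apply/matrixP => i j; have := A0 i j.
by rewrite !mxE => /eqP; rewrite tofrac_eq0 => /eqP.
Qed.

(** A kernel vector over the fraction field, cleared of denominators. *)
Lemma rows_dependent m n (A : 'M[R]_(m, n)) :
  (\rank A^F < m)%N -> exists2 w : 'rV[R]_m, w != 0 & w *m A = 0.
Proof.
move=> rA; have /rowV0Pn[v vker v0] : kermx A^F != 0.
  by rewrite -mxrank_eq0 mxrank_ker -lt0n subn_gt0.
have [w [d [d0 wd]]] := fraction_row_numden v; exists w.
  have : w^F != 0 by rewrite wd scaler_eq0 tofrac_eq0 negb_or d0.
  by apply: contraNneq => ->; rewrite map_mx0.
apply: map_tofrac_eq0.
by rewrite map_mxM wd -scalemxAl (sub_kermxP vker) scaler0.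
Qed.

(** Clearing denominators carries the inclusion of kernels to the fraction field, where the rank of
    [A] is then at most that of [C], hence at most its number of columns. *)
Lemma rank_kernel_le m n r (A : 'M[R]_(m, n)) (C : 'M[R]_(m, r)) :
  (forall w : 'rV_m, w *m C = 0 -> w *m A = 0) -> (\rank A^F <= r)%N.
Proof.
move=> CA; apply: leq_trans (rank_leq_col C^F).
have le : (kermx C^F <= kermx A^F)%MS.
  apply/rV_subP => v /sub_kermxP vC; apply/sub_kermxP.
  have [w [d [d0 wd]]] := fraction_row_numden v.
  have wC : w *m C = 0.
    by apply: map_tofrac_eq0; rewrite map_mxM wd -scalemxAl vC scaler0.
  have := congr1 (fun B => B^F) (CA w wC).
  rewrite /= map_mxM wd -scalemxAl map_mx0 => /eqP.
  by rewrite scaler_eq0 tofrac_eq0 (negPf d0) => /eqP.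
exact: rank_kermx_le le.
Qed.

End FractionMatrix.

Lemma rank_minor_exists (F : fieldType) m n (A : 'M[F]_(m, n)) :
  exists (f : 'I_(\rank A) -> 'I_m) (g : 'I_(\rank A) -> 'I_n),
    \det (mxsub f g A) != 0.
Proof.
have full : row_full (rowsub (maxrankfun A) A)^T.
  by rewrite /row_full mxrank_tr eq_maxrowsub.
exists (maxrankfun A), (fullrankfun full).
have := fullrowsub_unit full; rewrite unitmxE unitfE -det_tr.
congr (\det _ != 0); apply/matrixP => i j; by rewrite !mxE.
Qed.

Lemma rank_minor_le (F : fieldType) m n s (A : 'M[F]_(m, n))
    (f : 'I_s -> 'I_m) (g : 'I_s -> 'I_n) :
  \det (mxsub f g A) != 0 -> (s <= \rank A)%N.
Proof.
rewrite -unitfE -unitmxE -row_full_unit => /eqP {1}<-.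
rewrite (_ : mxsub f g A = rowsub f (colsub g A)); last first.
  by apply/matrixP => i j; rewrite !mxE.
apply: leq_trans (mxrankS (rowsub_sub _ _)) _.
rewrite -mxrank_tr -[X in (_ <= X)%N]mxrank_tr.
rewrite (_ : (colsub g A)^T = rowsub g A^T); last first.
  by apply/matrixP => i j; rewrite !mxE.
exact: mxrankS (rowsub_sub _ _).
Qed.

(* A non-vanishing maximal minor of the specialised matrix lifts. *)
Lemma rank_map_le (R S : idomainType) (phi : {rmorphism R -> S}) m n
    (A : 'M[R]_(m, n)) :
  (\rank (map_mx (@FracField.tofrac S) (map_mx phi A)) <=
   \rank (map_mx (@FracField.tofrac R) A))%N.
Proof.
have [f [g det0]] := rank_minor_exists (map_mx (@FracField.tofrac S) (map_mx phi A)).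
apply: (rank_minor_le (f := f) (g := g)).
apply: contraNneq det0; rewrite -!map_mxsub !det_map_mx => /eqP.
by rewrite tofrac_eq0 => /eqP->; rewrite !rmorph0.
Qed.

(** * Generic substitutions *)

Section GenericSubstitution.
Variables (k : comNzRingType) (n : nat).

(* The matrix [X] over the k-algebra [R] specialises to every matrix: this is
   all that is used of the matrix of indeterminates. *)
Definition is_generic (R : idomainType) (iota : {rmorphism k -> R})
    (X : 'M[R]_n) : Prop :=
  forall (S : idomainType) (phi : {rmorphism k -> S}) (B : 'M[S]_n),
    exists2 psi : {rmorphism R -> S}, map_mx psi X = B &
      forall c, psi (iota c) = phi c.

Definition subst (R : comNzRingType) (iota : {rmorphism k -> R}) (X : 'M[R]_n)
    (f : {mpoly k[n]}) : {mpoly R[n]} := lin_sub X (map_mpoly iota f).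

HB.instance Definition _ R iota X := GRing.RMorphism.copy (@subst R iota X)
  (lin_sub X \o map_mpoly iota).

Lemma map_subst (R S : comNzRingType) (iota : {rmorphism k -> R}) (X : 'M[R]_n)
    (psi : {rmorphism R -> S}) (phi : {rmorphism k -> S}) f :
  (forall c, psi (iota c) = phi c) ->
  map_mpoly psi (subst iota X f) = subst phi (map_mx psi X) f.
Proof.
move=> psiphi; rewrite /subst map_lin_sub; congr lin_sub.
by apply/mpolyP => m; rewrite !mcoeff_map_mpoly /=.
Qed.

Lemma subst_lin_sub (R S : comNzRingType) (iota : {rmorphism k -> R}) (X : 'M[R]_n)
    (phi : {rmorphism R -> S}) (C D : 'M[S]_n) f :
  lin_sub D (lin_sub C (map_mpoly phi (subst iota X f))) =
  subst (phi \o iota) (map_mx phi X *m C *m D) f.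
Proof.
have e : map_mpoly phi (map_mpoly iota f) = map_mpoly (phi \o iota) f.
  by apply/mpolyP => m; rewrite !mcoeff_map_mpoly.
by rewrite /subst map_lin_sub !lin_sub_comp e mulmxA.
Qed.

End GenericSubstitution.

(* Compare coefficients at the largest of the exponents [u x + m x], where
   [u x] is the leading exponent of [p x]. *)
Lemma lead_dependency (n : nat) (prec : rel 'X_{1..n}) (R : nzRingType)
    (T : finType) (p : T -> {mpoly R[n]}) (m : T -> 'X_{1..n}) :
  monomial_order prec -> (exists x, p x != 0) ->
  exists2 a : T -> R, (exists x, a x != 0) &
    forall H : T -> {mpoly R[n]}, (forall x, supp_bounded prec (m x) (H x)) ->
      \sum_x p x * H x = 0 -> \sum_x a x * (H x)@_(m x) = 0.
Proof.
move=> ord [x0 px0].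
have [u up] : exists u, forall x, p x != 0 -> lead prec (u x) (p x).
  apply: (fin_all_exists (P := fun x u => p x != 0 -> lead prec u (p x))) => x.
  have [px|/(lead_exists ord)[v ?]] := eqVneq (p x) 0; last by exists v.
  by exists 0%MM.
pose s := [seq (u x + m x)%MM | x <- enum T & p x != 0].
have ins x : p x != 0 -> (u x + m x)%MM \in s.
  by move=> px; apply/mapP; exists x; rewrite // mem_filter px mem_enum.
have [|v vs max_v] := prec_max_exists ord (s := s).
  by apply: contraTneq (ins _ px0) => ->.
(* [a] keeps the leading coefficients of those [p x] that reach the maximum [v]. It does not depend
   on [H], so one relation serves all families. *)
exists (fun x => if (p x != 0) && (u x + m x == v)%MM then (p x)@_(u x) else 0).
  move: vs => /mapP[x]; rewrite mem_filter => /andP[px _] ->.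
  by exists x; rewrite px eqxx; case: (up x px).
move=> H Hm /(congr1 (mcoeff v)); rewrite mcoeff0 raddf_sum /= => e; rewrite -[RHS]e {e}.
apply: eq_bigr => x _; case: eqVneq => [->|px] /=.
  by rewrite !mul0r mcoeff0.
have [_ pux] := up x px.
case: eqP => [<-|/eqP uv]; first by rewrite (mcoeff_mul_bounded ord).
rewrite mul0r (mcoeff_supp_bounded ord (u := (u x + m x)%MM)) //.
- exact: supp_bounded_mul.
- by apply: max_v; apply: ins.
- by rewrite eq_sym.
Qed.

(** * Quasi-stability of the generic leading exponents *)

Section QuasiStable.
Variables (k : comNzRingType) (n : nat) (prec : rel 'X_{1..n}).
Hypothesis ord : monomial_order prec.
Variables i j : 'I_n.
Hypothesis prec_ij : prec U_(i)%MM U_(j)%MM.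
Hypothesis neq_ij : i != j.
Variables (R : idomainType) (iota : {rmorphism k -> R}) (X : 'M[R]_n).
Hypothesis genX : is_generic iota X.
Local Notation R' := {mpoly R[n]}.

(** The effect of replacing X by X T g, where the diagonal entries of T are the variables of [R'].
    In a coefficient of the result, the monomial ['X_[m]] of [R'] marks what comes from the term
    x^m. *)
Definition torus_sub (g : {mpoly R[n]}) : {mpoly R'[n]} :=
  lin_sub (transvection R' i j)
    (lin_sub (diag_mx (\row_l 'X_l)) (map_mpoly (@mpolyC n R) g)).

HB.instance Definition _ := GRing.RMorphism.copy torus_sub
  (lin_sub (transvection R' i j) \o (lin_sub (diag_mx (\row_l 'X_l)) \o
    map_mpoly (@mpolyC n R))).

Lemma torus_subZ c g : torus_sub (c *: g) = c%:MP *: torus_sub g.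
Proof. by rewrite /torus_sub map_mpolyZ !lin_subZ. Qed.

(** The matrix X T g is itself a specialisation of X, so the substitution acts on the coefficients
    of f(X x) by a ring morphism. *)
Lemma torus_spec_exists : exists psi : {rmorphism R -> R'},
  forall f, map_mpoly psi (subst iota X f) = torus_sub (subst iota X f).
Proof.
pose B := map_mx (@mpolyC n R) X *m diag_mx (\row_l 'X_l) *m transvection R' i j.
have [psi psiX psiC] := genX (@mpolyC n R \o iota) B.
exists psi => f; rewrite (map_subst _ _ psiC) psiX /torus_sub.
by rewrite subst_lin_sub.
Qed.

Lemma torus_mcoeff (g : {mpoly R[n]}) v :
  (torus_sub g)@_v =
  \sum_(m <- msupp g)
    (g@_m * (lin_sub (transvection R i j) 'X_[m])@_v) *: 'X_[m].
Proof.
rewrite {1}(mpolyE g) (raddf_sum torus_sub) raddf_sum /=.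
apply: eq_bigr => m _.
rewrite torus_subZ mcoeffZ /torus_sub map_mpolyX lin_sub_diag lin_subZ mcoeffZ.
have -> : \prod_(l < n) (\row_l 'X_l : 'rV[R']_n) 0 l ^+ m l = 'X_[m].
  by rewrite [RHS]mpolyXE_id; apply: eq_bigr => l _; rewrite mxE.
rewrite (lin_sub_map_transvection (@mpolyC n R)) mcoeff_map_mpoly.
by rewrite [X in _ * X]mulrC mulrA -mpolyCM mul_mpolyC.
Qed.

(** The same order [prec] compares the monomials in the entries of T, so the leading term of [g]
    supplies the top coefficient at every [v]. *)
Lemma torus_lead u g v : lead prec u g ->
  supp_bounded prec u (torus_sub g)@_v /\
  ((torus_sub g)@_v)@_u = g@_u * (lin_sub (transvection R i j) 'X_[u])@_v.
Proof.
move=> [gu ug]; rewrite torus_mcoeff; split.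
  apply: supp_bounded_sum => w wg; apply: supp_boundedZ.
  by apply: (supp_bounded_trans ord (ug w wg)); apply: supp_boundedX.
rewrite (bigD1_seq u) ?msupp_uniq ?mcoeff_msupp //= mcoeffD mcoeffZ mcoeffX.
rewrite eqxx mulr1 (raddf_sum (mcoeff u)) /= [X in _ + X]big1 ?addr0 // => w wu.
by rewrite mcoeffZ mcoeffX (negPf wu) mulr0.
Qed.

Lemma generic_lead_move (q : nat) (f : 'I_q -> {mpoly k[n]}) (m : 'X_{1..n}) :
  (exists c : 'I_q -> R, lead prec m (\sum_l c l *: subst iota X (f l))) ->
  exists c : 'I_q -> R,
    lead prec (mnm_move i j m) (\sum_l c l *: subst iota X (f l)).
Proof.
pose F l := subst iota X (f l).
pose comb (c : 'I_q -> R) := \sum_l c l *: F l.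
pose U v := exists c, lead prec v (comb c).
have [psi psiE] := torus_spec_exists.
set d := mnm_move i j m; move=> Um; apply: NNPP => nUd.
have {Um nUd} [Um nUd] : U m /\ ~ U d by [].
pose ms := flatten [seq msupp (F l) | l <- enum 'I_q].
have F_ms l v : v \notin ms -> (F l)@_v = 0.
  apply: contraNeq; rewrite -mcoeff_msupp => vF.
  by apply/flattenP; exists (msupp (F l)) => //; apply: map_f; rewrite mem_enum.
have comb_coef c v : (comb c)@_v = \sum_l c l * (F l)@_v.
  by rewrite raddf_sum /=; apply: eq_bigr => l _; rewrite mcoeffZ.
have U_ms v : U v -> v \in ms.
  move=> [c [+ _]]; apply: contraNT => /F_ms v0.
  by rewrite comb_coef big1 // => l _; rewrite v0 mulr0.
(* [Ms] holds the leading exponents at or above [d], [Ks] all exponents of the supports at or above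
   [d]; they index the columns of [C] and [A]. *)
have [Ms uMs MsP] := seq_subset_exists ms (fun v => U v /\ prec d v).
have [Ks _ KsP] := seq_subset_exists ms (fun v => prec d v).
pose A := \matrix_(l < q, c < size Ks) (F l)@_(nth 0%MM Ks c).
pose C := \matrix_(l < q, c < size Ms) (F l)@_(nth 0%MM Ms c).
(* A combination that vanishes on [Ms] has no leading exponent at or above [d], so it vanishes on
   [Ks]. *)
have rankA : (\rank (map_mx (@FracField.tofrac R) A) <= size Ms)%N.
  apply: (rank_kernel_le (C := C)) => w wC.
  have wMs v : v \in Ms -> (comb (w 0))@_v = 0.
    move=> vMs; have /rowP/(_ (Ordinal (etrans (index_mem v Ms) vMs))) := wC.
    rewrite !mxE comb_coef => e; rewrite -[RHS]e; apply: eq_bigr => l _.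
    by rewrite mxE /= nth_index.
  apply/rowP => c; rewrite !mxE.
  have [_ dc] : nth 0%MM Ks c \in ms /\ prec d (nth 0%MM Ks c).
    by apply/KsP; apply: mem_nth.
  have : (comb (w 0))@_(nth 0%MM Ks c) = 0.
    apply/eqP; apply/negPn/negP => nz.
    have [v lv] : exists v, lead prec v (comb (w 0)).
      apply: (lead_exists ord); apply: contraNneq nz => ->.
      by rewrite mcoeff0.
    have vMs : v \in Ms.
      apply/MsP; split; first by apply: U_ms; exists (w 0).
      split; first by exists (w 0).
      case: lv => _ bv; apply: (mo_trans ord dc); apply: bv.
      by rewrite mcoeff_msupp.
    by case: lv => + _; rewrite wMs // eqxx.
  by rewrite comb_coef => e; rewrite -[RHS]e; apply: eq_bigr => l _; rewrite mxE.
pose r := size Ms; pose mu (x : 'I_r.+1) := nth 0%MM (m :: Ms) x.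
(* [d] occurs in the image of x^m and is therefore at or above [m]; if [m] were in [Ms], then [d] =
   [m] would lie in [U]. *)
have mMs : m \notin Ms.
  apply/negP => /MsP[_ [_ dm]]; apply: nUd.
  suff -> : d = m by [].
  apply: (monomial_order_eq ord) => //.
  apply: (transvection_ge (R := R) ord prec_ij neq_ij).
  by rewrite mcoeff_msupp (transvection_move _ ord) // oner_neq0.
have [c cP] : exists c, forall x, lead prec (mu x) (comb (c x)).
  apply: (fin_all_exists (P := fun x c => lead prec (mu x) (comb c))) => x.
  have : mu x \in m :: Ms by apply: mem_nth; rewrite /= ltnS; exact: ltn_ord x.
  by rewrite in_cons => /orP[/eqP->//|/MsP[_ []]].
pose D := \matrix_(x < r.+1, l < q) (c x l)%:MP_[n].
(* Specialising X to X T g cannot raise the rank, so these [r.+1] rows satisfy a relation over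
   [R']. *)
have [p p0 pA] : exists2 p : 'rV_r.+1, p != 0 &
    p *m (D *m map_mx psi A) = 0.
  apply: rows_dependent; rewrite ltnS map_mxM.
  apply: leq_trans (mxrankM_maxr _ _) _.
  exact: leq_trans (rank_map_le _ _) rankA.
pose G v x := (torus_sub (comb (c x)))@_v.
have pG v : prec d v -> \sum_x p 0 x * G v x = 0.
  move=> dv.
  have Gv x : G v x = \sum_l (c x l)%:MP * psi (F l)@_v.
    rewrite /G /comb (raddf_sum torus_sub) raddf_sum /=; apply: eq_bigr => l _.
    by rewrite torus_subZ mcoeffZ -psiE mcoeff_map_mpoly.
  have [vms|vms] := boolP (v \in ms); last first.
    apply: big1 => x _; rewrite Gv big1 ?mulr0 // => l _.
    by rewrite F_ms // raddf0 mulr0.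
  have vKs : v \in Ks by apply/KsP.
  have /rowP/(_ (Ordinal (etrans (index_mem v Ks) vKs))) := pA.
  rewrite !mxE => e; rewrite -[RHS]e; apply: eq_bigr => x _; congr (_ * _).
  by rewrite Gv mxE; apply: eq_bigr => l _; rewrite !mxE /= nth_index.
(* The top part of the relation in the entries of T involves only the leading terms of the chosen
   combinations. *)
have [|a [x ax] aP] := lead_dependency (p := p 0) mu ord.
  by apply/existsP; apply: contraNT p0 => /existsPn h; apply/eqP/rowP => x;
    rewrite mxE; apply/eqP; have := h x; rewrite negbK.
pose tr v := lin_sub (transvection R i j) ('X_[v] : {mpoly R[n]}).
have rel v : prec d v ->
    \sum_x a x * ((comb (c x))@_(mu x) * (tr (mu x))@_v) = 0.
  move=> dv; rewrite -[RHS](aP (G v)) ?pG //; last first.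
    by move=> y; case: (torus_lead v (cP y)).
  apply: eq_bigr => y _; congr (_ * _).
  by case: (torus_lead v (cP y)).
have ge_d y : y != ord0 -> mu y \in Ms.
  by case: y => [[|y] yr] // _; apply: mem_nth; rewrite -ltnS.
(* At [d] only [m] contributes: an exponent of [Ms] whose image contains [d] would be both above and
   below [d], which puts [d] into [U]. *)
have a0 : a ord0 = 0.
  have := rel d (monomial_order_refl ord d); rewrite (bigD1 ord0) //= big1.
    rewrite addr0 /tr (transvection_move _ ord) // mulr1 => /eqP.
    by rewrite mulf_eq0 => /orP[/eqP //|]; case: (cP ord0) => /negPf ->.
  move=> y /ge_d/MsP[_ [Uy dy]].
  suff -> : (tr (mu y))@_d = 0 by rewrite !mulr0.
  apply: memN_msupp_eq0; apply/negP => /(transvection_ge ord prec_ij neq_ij) yd.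
  by apply: nUd; rewrite (monomial_order_eq ord dy yd).
(* Take the least [mu y] with [a y] nonzero. By unitriangularity it alone survives in the relation
   at its own exponent, a contradiction. *)
pose s := [seq mu y | y <- enum 'I_r.+1 & a y != 0].
have ins y : a y != 0 -> mu y \in s.
  by move=> ay; apply/mapP; exists y; rewrite // mem_filter ay mem_enum.
have [|v vs min_v] := prec_max_exists (monomial_order_rev ord) (s := s).
  by apply: contraTneq (ins _ ax) => ->.
move: vs => /mapP[y]; rewrite mem_filter => /andP[ay _] vy.
have y0 : y != ord0 by apply: contraNneq ay => ->; rewrite a0.
have := rel v; rewrite (bigD1 y) //= big1.
  rewrite addr0 vy /tr (transvection_diag _ ord) // mulr1 => h.
  have /eqP : a y * (comb (c y))@_(mu y) = 0.
    by apply: h; have /MsP[_ []] := ge_d _ y0.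
  by rewrite mulf_eq0 (negPf ay); case: (cP y) => /negPf ->.
move=> z zy; have [->|az] := eqVneq (a z) 0; first by rewrite mul0r.
suff -> : (tr (mu z))@_v = 0 by rewrite !mulr0.
apply: memN_msupp_eq0; apply/negP => /(transvection_ge ord prec_ij neq_ij) zv.
move/eqP: zy; apply; apply: val_inj => /=.
have : mu z = mu y.
  by rewrite -vy; apply: (monomial_order_eq ord) => //; apply: min_v; apply: ins.
move/eqP; rewrite nth_uniq /= ?mMs ?uMs //; first by move/eqP.
Qed.

End QuasiStable.

(** * Spans of substituted ideals, normal forms and specialisation *)

Section SubstSpan.
Variables (k : comNzRingType) (n : nat) (prec : rel 'X_{1..n}).
Hypothesis prec_to : term_order prec.
Let ord := term_order_monomial prec_to.
Variable I : {mpoly k[n]} -> Prop.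
Hypothesis idealI :
  [/\ I 0, forall f g, I f -> I g -> I (f + g) & forall f g : {mpoly k[n]}, I g -> I (f * g)].

Section Span.
Variables (R : idomainType) (iota : {rmorphism k -> R}) (X : 'M[R]_n).

Definition subst_span (g : {mpoly R[n]}) : Prop :=
  exists2 s : seq (R * {mpoly k[n]}), (forall x, x \in s -> I x.2) &
    g = \sum_(x <- s) x.1 *: subst iota X x.2.

Definition span_lead (m : 'X_{1..n}) : Prop :=
  exists2 g, subst_span g & lead prec m g.

(** Membership up to a nonzero scalar. It absorbs the factor [\det X] of [span_mulX] and does not
    enlarge the set of leading exponents. *)
Definition subst_sat (g : {mpoly R[n]}) : Prop :=
  exists2 c, c != 0 & subst_span (c *: g).

Lemma span0 : subst_span 0.
Proof. by exists [::] => //; rewrite big_nil. Qed.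

Lemma span_subst f : I f -> subst_span (subst iota X f).
Proof.
move=> If; exists [:: (1, f)] => [x|]; first by rewrite inE => /eqP->.
by rewrite big_seq1 scale1r.
Qed.

Lemma spanD f g : subst_span f -> subst_span g -> subst_span (f + g).
Proof.
move=> [s sI ->] [t tI ->]; exists (s ++ t) => [x|]; last by rewrite big_cat.
by rewrite mem_cat => /orP[/sI|/tI].
Qed.

Lemma spanZ c g : subst_span g -> subst_span (c *: g).
Proof.
move=> [s sI ->]; exists [seq (c * x.1, x.2) | x <- s] => [x|].
  by move=> /mapP[y /sI ? ->].
by rewrite big_map scaler_sumr; apply: eq_bigr => x _; rewrite scalerA.
Qed.

Lemma span_sum (T : eqType) (r : seq T) (F : T -> {mpoly R[n]}) :
  (forall x, x \in r -> subst_span (F x)) -> subst_span (\sum_(x <- r) F x).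
Proof.
elim: r => [|x r IH] rF; first by rewrite big_nil; apply: span0.
rewrite big_cons; apply: spanD; first by apply: rF; rewrite mem_head.
by apply: IH => y ry; apply: rF; rewrite in_cons ry orbT.
Qed.

Lemma span_mulX l g : subst_span g -> subst_span (\det X *: ('X_l * g)).
Proof.
case: idealI => _ _ mulI [s sI ->].
rewrite mulr_sumr scaler_sumr; apply: span_sum => x /sI Ix.
rewrite -scalerAr scalerA mulrC -scalerA scalerAl det_scaleX.
apply: spanZ; rewrite mulr_suml; apply: span_sum => j _.
rewrite -scalerAl; apply: spanZ.
have -> : lin_sub X 'X_j * subst iota X x.2 = subst iota X ('X_j * x.2).
  by rewrite rmorphM /= /subst map_mpolyX.
exact/span_subst/mulI.
Qed.

Hypothesis detX : \det X != 0.

Lemma span_sat g : subst_span g -> subst_sat g.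
Proof. by move=> gs; exists 1; [exact: oner_neq0|rewrite scale1r]. Qed.

Lemma satD f g : subst_sat f -> subst_sat g -> subst_sat (f + g).
Proof.
move=> [c c0 cf] [d d0 dg]; exists (c * d); first exact: mulf_neq0.
rewrite scalerDr; apply: spanD; last by rewrite -scalerA; apply: spanZ.
by rewrite mulrC -scalerA; apply: spanZ.
Qed.

Lemma satZ c g : subst_sat g -> subst_sat (c *: g).
Proof.
by move=> [d d0 dg]; exists d => //; rewrite scalerA mulrC -scalerA; apply: spanZ.
Qed.

Lemma satB f g : subst_sat f -> subst_sat g -> subst_sat (f - g).
Proof. by move=> sf sg; apply: satD sf _; rewrite -scaleN1r; apply: satZ. Qed.

Lemma sat_sum (T : eqType) (r : seq T) (F : T -> {mpoly R[n]}) :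
  (forall x, x \in r -> subst_sat (F x)) -> subst_sat (\sum_(x <- r) F x).
Proof.
elim: r => [|x r IH] rF; first by rewrite big_nil; apply/span_sat/span0.
rewrite big_cons; apply: satD; first by apply: rF; rewrite mem_head.
by apply: IH => y ry; apply: rF; rewrite in_cons ry orbT.
Qed.

Lemma sat_mulX m g : subst_sat g -> subst_sat ('X_[m] * g).
Proof.
rewrite mpolyXE_id.
elim/big_rec: _ => [|l p _ IH gs]; first by rewrite mul1r.
rewrite -mulrA; elim: (m l) => [|e IHe]; first by rewrite expr0 mul1r; apply: IH.
rewrite exprS -mulrA; case: IHe => c c0 cs.
exists (\det X * c); first exact: mulf_neq0.
by rewrite -scalerA scalerAr; apply: span_mulX.
Qed.

Lemma sat_lead m g : subst_sat g -> lead prec m g -> span_lead m.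
Proof.
by move=> [c c0 cg] gm; exists (c *: g) => //; apply: lead_scale.
Qed.

Lemma span_lead_dvd u v : span_lead u -> (u <= v)%MM -> span_lead v.
Proof.
move=> [g gs gu] uv; apply: (sat_lead (g := 'X_[v - u] * g)).
  exact/sat_mulX/span_sat.
by rewrite -{1}(submK uv); apply: (lead_mul ord); first exact: leadX.
Qed.

Lemma sat_standard_eq0 g :
  subst_sat g -> (forall m, m \in msupp g -> ~ span_lead m) -> g = 0.
Proof.
move=> gs gU; apply/eqP/negPn/negP => /(lead_exists ord)[m gm].
apply: (gU m); first by case: gm; rewrite mcoeff_msupp.
exact: sat_lead gm.
Qed.

(** Each element is scaled by the leading coefficients of the others, so that one [P] is the only
    denominator of the reduction. *)
Lemma common_lead_coef (s : seq 'X_{1..n}) :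
  (forall u, u \in s -> span_lead u) ->
  exists2 P : R, P != 0 & forall u, u \in s ->
    exists g, [/\ subst_span g, lead prec u g & g@_u = P].
Proof.
elim: s => [|u s IH] sU; first by exists 1 => //; apply: oner_neq0.
have [v vs|P P0 PP] := IH; first by apply: sU; rewrite in_cons vs orbT.
have [|g gs gu] := sU u; first exact: mem_head.
have g0 : g@_u != 0 by case: gu.
exists (P * g@_u) => [|v]; first exact: mulf_neq0.
rewrite in_cons => /orP[/eqP->|/PP[h [hs hv hP]]].
  by exists (P *: g); split; [apply: spanZ|apply: lead_scale|rewrite mcoeffZ].
exists (g@_u *: h); split; [exact: spanZ|exact: lead_scale|].
by rewrite mcoeffZ hP mulrC.
Qed.

Variables (s : seq 'X_{1..n}) (P : R).
Hypothesis s_gen : forall v, span_lead v -> exists2 u, u \in s & (u <= v)%MM.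
Hypothesis s_lead : forall u, u \in s ->
  exists g, [/\ subst_span g, lead prec u g & g@_u = P].

(** [q] is a remainder of x^v modulo the span, with denominators cleared by [P ^+ e]. *)
Definition normal_form (e : nat) (v : 'X_{1..n}) (q : {mpoly R[n]}) :=
  [/\ supp_bounded prec v q, forall m, m \in msupp q -> ~ span_lead m &
      subst_sat (P ^+ e *: 'X_[v] - q)].

(** Remainders may be multiplied by powers of [P], so finitely many of them share one exponent
    [e]. *)
Lemma normal_form_seq (t : seq 'X_{1..n}) :
  (forall v, v \in t -> exists e q, normal_form e v q) ->
  exists e q, forall v, v \in t -> normal_form e v (q v).
Proof.
have shift d e v q : normal_form e v q -> normal_form (d + e) v (P ^+ d *: q).
  move=> [vq qU qs]; split; first exact: supp_boundedZ.
    by move=> m /msuppZ_le /qU.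
  by rewrite exprD -scalerA -scalerBr; apply: satZ.
elim: t => [|v t IH] tnf; first by exists 0%N, (fun _ => 0).
have [w wt|e [q qP]] := IH; first by apply: tnf; rewrite in_cons wt orbT.
have [|d [p pP]] := tnf v; first exact: mem_head.
exists (e + d)%N, (fun w => if w == v then P ^+ e *: p else P ^+ d *: q w) => w.
rewrite in_cons; case: eqP => [->|_] /= wt; first exact: shift.
by rewrite addnC; apply: shift; apply: qP.
Qed.

Lemma normal_form_sum e (q : 'X_{1..n} -> {mpoly R[n]}) (t : seq 'X_{1..n}) g :
  uniq t -> {subset msupp g <= t} ->
  (forall v, v \in t -> normal_form e v (q v)) ->
  subst_sat (P ^+ e *: g - \sum_(v <- t) g@_v *: q v).
Proof.
move=> ut gt qP; have {1}-> : g = \sum_(v <- t) g@_v *: 'X_[v].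
  apply/mpolyP => m; rewrite raddf_sum /=.
  under eq_bigr => v _ do rewrite mcoeffZ mcoeffX.
  have [mt|mt] := boolP (m \in t).
    rewrite (bigD1_seq m) //= eqxx mulr1 big1 ?addr0 // => v vm.
    by rewrite (negPf vm) mulr0.
  rewrite big1_seq ?memN_msupp_eq0 //; first by apply: contra mt; apply: gt.
  move=> v /= vt; case: eqP => [vm|_]; last by rewrite mulr0.
  by rewrite -vm vt in mt.
rewrite scaler_sumr -sumrB; apply: sat_sum => v vt.
rewrite scalerA mulrC -scalerA -scalerBr; apply: satZ.
by case: (qP v vt).
Qed.

Lemma normal_form_exists v : exists e q, normal_form e v q.
Proof.
apply: (term_order_ind (Q := fun v => exists e q, normal_form e v q) prec_to).
move=> {}v IH; have [Uv|nUv] := classic (span_lead v); last first.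
  exists 0%N, 'X_[v]; split; first exact: supp_boundedX.
    by move=> m; rewrite msuppX inE => /eqP->.
  by rewrite expr0 scale1r subrr; apply/span_sat/span0.
have [u us uv] := s_gen Uv; have [g [gs [_ gu] gP]] := s_lead us.
(* One reduction step: the leading terms cancel in [w], which has only exponents below [v]. The step
   costs one factor [P], whence [e.+1]. *)
pose h := 'X_[v - u] * g; pose w := P *: 'X_[v] - h.
have bh : supp_bounded prec v h.
  rewrite -{1}(submK uv).
  by apply: (supp_bounded_mul ord) => //; apply: supp_boundedX.
have hv : h@_v = P.
  rewrite -{1}(submK uv) (mcoeff_mul_bounded ord) //; last exact: supp_boundedX.
  by rewrite mcoeffX eqxx mul1r.
have bw : supp_bounded prec v w.
  apply: supp_boundedD; first by apply: supp_boundedZ; apply: supp_boundedX.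
  by move=> m; rewrite (perm_mem (msuppN h)); apply: bh.
have wv : w@_v = 0 by rewrite mcoeffB mcoeffZ mcoeffX eqxx mulr1 hv subrr.
have lt_wv m : m \in msupp w -> m != v.
  by rewrite mcoeff_msupp; apply: contraNneq => ->; rewrite wv.
have [m mw|e [q qP]] := @normal_form_seq (msupp w).
  by apply: IH; [apply: bw|apply: lt_wv].
exists e.+1, (\sum_(m <- msupp w) w@_m *: q m); split.
- apply: supp_bounded_sum => m mw; apply: supp_boundedZ.
  by have [bq _ _] := qP m mw; apply: (supp_bounded_trans ord (bw m mw)).
- move=> m /msupp_sum_le /flattenP[r /mapP[x]].
  by rewrite mem_filter /= => xw -> /msuppZ_le; case: (qP x xw) => _ + _; apply.
have -> : P ^+ e.+1 *: 'X_[v] - \sum_(m <- msupp w) w@_m *: q m =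
    P ^+ e *: h + (P ^+ e *: w - \sum_(m <- msupp w) w@_m *: q m).
  by rewrite addrA -scalerDr; congr (_ - _); rewrite /w addrC addrNK scalerA exprSr.
apply: satD; first by apply: satZ; apply/sat_mulX/span_sat.
exact: normal_form_sum.
Qed.

End Span.

(* Applying the specialised normal forms to an element of the specialised span
   gives 0, because it does so generically. *)
Lemma span_lead_specialize (R S : idomainType) (iota : {rmorphism k -> R})
    (X : 'M[R]_n) (psi : {rmorphism R -> S}) (phi : {rmorphism k -> S})
    (s : seq 'X_{1..n}) (P : R) :
  (forall c, psi (iota c) = phi c) -> \det X != 0 ->
  (forall u, u \in s -> exists g, [/\ subst_span iota X g, lead prec u g & g@_u = P]) ->
  (forall v, span_lead iota X v -> exists2 u, u \in s & (u <= v)%MM) ->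
  psi P != 0 -> psi (\det X) != 0 ->
  forall m, span_lead phi (map_mx psi X) m <-> span_lead iota X m.
Proof.
move=> psiphi detX s_lead s_gen psiP psidet m; split; last first.
  move=> /s_gen[u us um]; apply: span_lead_dvd um; first by rewrite det_map_mx.
  have [g [[t tI gE] [_ gu] gP]] := s_lead u us.
  exists (map_mpoly psi g).
    exists [seq (psi x.1, x.2) | x <- t] => [x /mapP[y /tI ? -> //]|].
    rewrite big_map gE raddf_sum; apply: eq_bigr => x _ /=.
    by rewrite map_mpolyZ (map_subst _ _ psiphi).
  split; first by rewrite mcoeff_map_mpoly gP.
  move=> v; rewrite mcoeff_msupp mcoeff_map_mpoly => gv; apply: gu.
  by rewrite mcoeff_msupp; apply: contraNneq gv => ->; rewrite raddf0.
move=> [h [t tI hE] [hm bh]]; apply: NNPP => nUm.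
pose F (x : S * {mpoly k[n]}) := subst iota X x.2.
pose ms := undup (m :: flatten [seq msupp (F x) | x <- t]).
have [v _|e [q qP]] := @normal_form_seq _ iota X P ms.
  exact: normal_form_exists s_gen s_lead _.
(* The remainder of f(X x) for f in I lies in the saturated span and has no leading exponent of the
   span in its support. *)
have Fq x : x \in t -> \sum_(v <- ms) (F x)@_v *: q v = 0.
  move=> xt; have sub : {subset msupp (F x) <= ms}.
    move=> v vF; rewrite mem_undup in_cons; apply/orP; right.
    by apply/flattenP; exists (msupp (F x)) => //; apply: map_f.
  apply: (sat_standard_eq0 (iota := iota) (X := X)).
    have := normal_form_sum (undup_uniq _) sub qP.
    move=> /(satB (satZ (P ^+ e) (span_sat (span_subst iota X (tI x xt))))).
    by rewrite opprB addrC addrNK.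
  move=> v /msupp_sum_le /flattenP[r /mapP[y]].
  by rewrite mem_filter /= => yt -> /msuppZ_le; case: (qP y yt) => _ + _; apply.
have hq : \sum_(v <- ms) h@_v * psi (q v)@_m = 0.
  have hv v : h@_v = \sum_(x <- t) x.1 * psi (F x)@_v.
    rewrite hE raddf_sum /=; apply: eq_bigr => x _.
    by rewrite mcoeffZ -(map_subst _ _ psiphi) mcoeff_map_mpoly.
  under eq_bigr => v _ do rewrite hv mulr_suml.
  rewrite exchange_big big1_seq //= => x /Fq /(congr1 (mcoeff m)).
  rewrite raddf_sum mcoeff0 => /(congr1 psi); rewrite raddf0 raddf_sum /= => e0.
  under eq_bigr => v _ do rewrite -mulrA.
  rewrite -mulr_sumr.
  under eq_bigr => v _ do rewrite -rmorphM -mcoeffZ.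
  by rewrite e0 mulr0.
have mms : m \in ms by rewrite mem_undup mem_head.
have [_ qU qs] := qP m mms.
(* As [m] is not a generic leading exponent, [P ^+ e *: 'X_[m]] is already reduced. *)
have qm : P ^+ e *: 'X_[m] = q m.
  apply/eqP; rewrite -subr_eq0; apply/eqP.
  apply: (sat_standard_eq0 (iota := iota) (X := X)) => // v /msuppB_le.
  rewrite mem_cat => /orP[/msuppZ_le|/qU //].
  by rewrite msuppX inE => /eqP->.
(* For [v] below [m] the remainder [q v] stays below [m]. Only [v] = [m] contributes at [m], with a
   nonzero value. *)
move: hq; rewrite (bigD1_seq m) ?undup_uniq //= big1_seq => [|v /andP[vm vms]].
  rewrite addr0 -qm mcoeffZ mcoeffX eqxx mulr1 rmorphXn => /eqP.
  by rewrite mulf_eq0 (negPf hm) expf_eq0 (negPf psiP) andbF.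
have [->|hv] := eqVneq h@_v 0; first by rewrite mul0r.
have pvm : prec v m by apply: bh; rewrite mcoeff_msupp.
have [bq _ _] := qP v vms.
suff -> : (q v)@_m = 0 by rewrite raddf0 mulr0.
by apply: (mcoeff_supp_bounded ord bq pvm); rewrite eq_sym.
Qed.

End SubstSpan.

(** * The matrix of indeterminates and points where a polynomial does not vanish *)

Section GenericMatrix.
Variables (k : fieldType) (n : nat).

Definition generic_mx : 'M[{mpoly k[n * n]}]_n :=
  \matrix_(i, j) 'X_(mxvec_index i j).

Lemma generic_mx_generic :
  is_generic (R := {mpoly k[n * n]}) (@mpolyC (n * n) k) generic_mx.
Proof.
move=> S phi B; exists (mmap phi (fun v => mxvec B 0 v)) => [|c].
  by apply/matrixP => i j; rewrite !mxE /= mmapX mmap1U mxvecE.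
exact: mmapC.
Qed.

End GenericMatrix.

(** X specialises to the identity matrix. *)
Lemma generic_det_neq0 (k : fieldType) (n : nat) (R : idomainType)
    (iota : {rmorphism k -> R}) (X : 'M[R]_n) :
  is_generic iota X -> \det X != 0.
Proof.
move=> genX; have [psi psiX _] := genX k idfun 1%:M.
have : psi (\det X) != 0 by rewrite -det_map_mx psiX det1 oner_neq0.
by apply: contraNneq => ->; rewrite rmorph0.
Qed.

Lemma horner_mmap (n : nat) (R : comNzRingType) (S : comNzRingType)
    (f : R -> S) (h : 'I_n -> {poly S}) (p : {mpoly R[n]}) x :
  (mmap (fun c => (f c)%:P) h p).[x] = mmap f (fun i => (h i).[x]) p.
Proof.
rewrite /mmap horner_sum; apply: eq_bigr => m _.
rewrite hornerM hornerC horner_prod; congr (_ * _).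
by apply: eq_bigr => i _; rewrite horner_exp.
Qed.

Lemma size_mmap_leq (n : nat) (R : nzRingType) (S : idomainType)
    (f : R -> S) (h : 'I_n -> {poly S}) (p : {mpoly R[n]}) :
  (forall i, (size (h i) <= 2)%N) ->
  (size (mmap (fun c => (f c)%:P) h p) <= msize p)%N.
Proof.
move=> h2; apply: (leq_trans (size_sum _ _ _)).
rewrite big_seq; elim/big_rec: _ => // m x mp xp.
rewrite geq_max xp andbT mul_polyC.
apply: (leq_trans (size_scale_leq _ _)).
apply: leq_trans (msize_mdeg_lt mp); rewrite mdegE /mmap1.
elim/big_rec2: _ => [|i d q _ IH]; first by rewrite size_poly1.
apply: (leq_trans (size_polyMleq _ _)).
have : (size (h i ^+ m i) <= (m i).+1)%N.
  apply: (leq_trans (size_poly_exp_leq _ _)).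
  by have := h2 i; case: (size (h i)) => [|[|[|]]] //= _; lia.
by move: IH; move: (size _) (size d) => a b; lia.
Qed.

(** Variables are replaced by elements of [s] one at a time. In each step a nonzero univariate
    polynomial of size at most [msize p] has fewer roots than [s] has elements. *)
Lemma mpoly_nonvanishing (K : fieldType) (m : nat) (p : {mpoly K[m]}) (s : seq K) :
  p != 0 -> uniq s -> (msize p <= size s)%N -> exists v : 'I_m -> K, p.@[v] != 0.
Proof.
move=> p0 us ps.
pose part j (v : 'I_m -> K) (i : 'I_m) : {mpoly K[m]} :=
  if (i < j)%N then (v i)%:MP else 'X_i.
have step j : (j <= m)%N -> exists v, mmap (@mpolyC m K) (part j v) p != 0.
  elim: j => [|j IH] jm.
    exists (fun _ => 0); suff -> : mmap (@mpolyC m K) (part 0%N (fun _ => 0)) p = p by [].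
    by rewrite [RHS]mpolyE /mmap; apply: eq_bigr => u _; rewrite mmap1_id mul_mpolyC.
  have [v v0] := IH (ltnW jm).
  pose c := Ordinal jm.
  (* The next variable becomes the indeterminate of [Q]; evaluating [Q] at ['X_c] returns the
     previous polynomial, so [Q] is nonzero. *)
  pose h i : {poly {mpoly K[m]}} := if i == c then 'X else (part j v i)%:P.
  pose Q := mmap (fun a => (a%:MP_[m])%:P) h p.
  have Q0 : Q != 0.
    apply: contraNneq v0 => /(congr1 (fun q : {poly _} => q.['X_c])).
    rewrite horner0 /Q horner_mmap => e; rewrite -[X in _ == X]e; apply/eqP.
    rewrite /mmap; apply: eq_bigr => u _; congr (_ * _); apply: mmap1_eq => i.
    rewrite /h; case: eqP => [->|_]; last by rewrite hornerC.
    by rewrite hornerX /part /= ltnn.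
  have [a as_ Qa] : exists2 a, a \in s & Q.[a%:MP] != 0.
    apply: NNPP => none.
    have : all (root Q) [seq a%:MP | a <- s].
      apply/allP => _ /mapP[a as_ ->]; apply/negPn/negP => Qa.
      by apply: none; exists a.
    move=> /(max_poly_roots Q0); rewrite map_inj_uniq; last first.
      exact: (inj_comp (fun _ _ => id) (can_inj (@mpolyCK m K))).
    move=> /(_ us); rewrite size_map ltnNge (leq_trans _ ps) //.
    apply: size_mmap_leq => i; rewrite /h; case: eqP => _.
      by rewrite size_polyX.
    exact: leq_trans (size_polyC_leq1 _) _.
  exists (fun i => if i == c then a else v i).
  move: Qa; rewrite /Q horner_mmap; congr (_ != 0).
  rewrite /mmap; apply: eq_bigr => u _; congr (_ * _); apply: mmap1_eq => i.
  rewrite /h /part ltnS [in RHS]leq_eqVlt -[X in X || _]/(i == c).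
  by case: eqP => [->|_] /=; rewrite ?hornerX ?hornerC.
have [v v0] := step m (leqnn m); exists v.
apply: contraNneq v0 => pv; rewrite -(mpolyC0 m K) -pv /meval /mmap.
rewrite (rmorph_sum (@mpolyC m K)).
apply/eqP; apply: eq_bigr => u _; rewrite rmorphM rmorph_prod /=; congr (_ * _).
by apply: eq_bigr => i _; rewrite /part ltn_ord rmorphXn.
Qed.

Lemma mmap_nonvanishing (k K : fieldType) (phi : {rmorphism k -> K}) (m : nat)
    (p : {mpoly k[m]}) :
  p != 0 -> has_at_least (msize p) K ->
  exists v : 'I_m -> K, mmap phi v p != 0.
Proof.
move=> p0 [s us ps].
have perm := msupp_map_mpoly p (fmorph_inj phi).
have q0 : map_mpoly phi p != 0.
  by rewrite -msupp_eq0 -size_eq0 (perm_size perm) size_eq0 msupp_eq0.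
have [|v v0] := mpoly_nonvanishing q0 us.
  by rewrite (leq_trans _ ps) // !msizeE (perm_big _ perm).
exists v; apply: contraNneq v0 => <-; apply/eqP.
rewrite /meval /mmap (perm_big _ perm) /=.
by apply: eq_bigr => u _; rewrite mcoeff_map_mpoly.
Qed.

(** * Pommaret cones and quasi-stable sets *)

(** For [u] = 0 both sides fail, since [j.+1] is at most the default value [n]. *)
Lemma cls_leP (n : nat) (u : 'X_{1..n}) (j : 'I_n) :
  (cls u < j.+1)%N <-> exists2 i : 'I_n, (i < j)%N & u i != 0%N.
Proof.
have cls_min d : (d <= cls u)%N <-> (d <= n)%N /\ forall i, u i != 0%N -> (d <= i.+1)%N.
  rewrite /cls; split.
    rewrite -big_filter => le; split; last first.
      move=> i ui; have : i \in [seq i <- index_enum 'I_n | u i != 0%N].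
        by rewrite mem_filter ui mem_index_enum.
      elim: [seq _ <- _ | _] le => [//|x r IH]; rewrite big_cons leq_min.
      by move=> /andP[dx /IH dr]; rewrite in_cons => /orP[/eqP->|/dr].
    elim: [seq _ <- _ | _] le => [|x r IH]; first by rewrite big_nil.
    by rewrite big_cons leq_min => /andP[_ /IH].
  move=> [dn du]; elim/big_rec: _ => // i x ui dx.
  by rewrite leq_min du.
split=> [lt|[i ij ui]]; last first.
  rewrite ltnNge; apply/negP => /cls_min[_ /(_ i ui)].
  by rewrite ltnS leqNgt ij.
apply: NNPP => none; move: lt; rewrite ltnNge => /negP; apply.
apply/cls_min; split=> [|i ui]; first exact: ltn_ord.
rewrite ltnS leqNgt; apply/negP => ij; apply: none.
by exists i.
Qed.

Lemma pommaret_coneP (n : nat) (u m : 'X_{1..n}) :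
  pommaret_cone u m <->
  (u <= m)%MM /\ forall i j : 'I_n, (i < j)%N -> u i != 0%N -> m j = u j.
Proof.
split=> [[r r0 ->]|[um mu]].
  split; first exact: lem_addr.
  move=> i j ij ui; rewrite mnmDE r0 ?addn0 //.
  by apply/cls_leP; exists i.
exists (m - u)%MM => [j /cls_leP[i ij ui]|]; last by rewrite addmC submK.
by rewrite mnmBE (mu i j) // subnn.
Qed.

Lemma first_nonzero (n : nat) (m : 'X_{1..n}) (j : 'I_n) : m j != 0%N ->
  exists c : 'I_n, [/\ m c != 0%N, (c <= j)%N &
    forall l : 'I_n, (l < c)%N -> m l = 0%N].
Proof.
move=> mj; case: (arg_minnP (fun c : 'I_n => c : nat) (P := fun c => m c != 0%N) mj).
move=> c mc min_c; exists c; split=> //; first exact: min_c.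
by move=> l lc; apply/eqP; apply: contraTT lc => /min_c; rewrite -leqNgt.
Qed.

Section PommaretDecomposition.
Variables (n : nat) (U : 'X_{1..n} -> Prop).
Hypothesis U_up : forall u v, U u -> (u <= v)%MM -> U v.
Hypothesis U_move : forall m (i j : 'I_n), (i < j)%N -> U m -> U (mnm_move i j m).

(* The Pommaret divisors of [m] form a chain: one divides repeatedly by the
   variable of smallest index.  The minimal elements are the ends in [U] of
   these chains. *)
Definition pommaret_minimal (u : 'X_{1..n}) : Prop :=
  U u /\ forall c : 'I_n, (forall l : 'I_n, (l < c)%N -> u l = 0%N) ->
    u c != 0%N -> ~ U (u - U_(c))%MM.

(** Let [D] bound the exponents of finitely many generators, let [c] be the first index of [u] and
    let [g] be a generator dividing [u]. Minimality forces [g c] = [u c]. If some later [u j]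
    exceeded [D + D], then [g] with x_c moved to x_j would divide [u] over x_c. *)
Lemma pommaret_minimal_bounded :
  exists D, forall u, pommaret_minimal u -> forall j, (u j <= D)%N.
Proof.
have [s sU sP] := dickson U.
have [D sD] : exists D, forall g j, g \in s -> (g j <= D)%N.
  elim: s {sU sP} => [|g s [D IH]]; first by exists 0%N.
  exists (\max_(j < n) g j + D)%N => h j; rewrite in_cons => /orP[/eqP->|/(IH _ j) le].
    by rewrite (leq_trans (leq_bigmax j)) ?leq_addr.
  exact: leq_trans (leq_addl _ _).
exists (D + D)%N => u [Uu min_u] j.
have [->//|uj] := eqVneq (u j) 0%N.
have [c [uc cj u0]] := first_nonzero uj.
have nU := min_u c u0 uc; have [g gs gu] := sP u Uu.
have Ug := sU g gs; have gle l : (g l <= u l)%N by apply/mnm_lepP.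
have gc : g c = u c.
  apply/eqP; rewrite eqn_leq gle leqNgt; apply/negP => lt; apply: nU.
  apply: (U_up Ug); apply/mnm_lepP => l; rewrite mnmBE mnm1E.
  by case: eqP => [<-|_] /=; [rewrite leq_subRL; lia|rewrite subn0].
have [cj'|] := ltnP c j; last first.
  move=> jc; have -> : j = c by apply: val_inj; apply/eqP; rewrite eqn_leq jc cj.
  by rewrite -gc (leq_trans (sD _ _ gs)) ?leq_addr.
rewrite leqNgt; apply/negP => lt; apply: nU.
apply: (U_up (U_move cj' Ug)); apply/mnm_lepP => l.
rewrite mnmE mnmBE mnm1E eq_sym; case: eqP => [//|_] /=; rewrite subn0.
case: eqP => [->|_] //.
by have := sD g j gs; have := sD g c gs; lia.
Qed.

(** Induction on the degree: a non-minimal [m] is divided by its variable of smallest index, and a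
    cone containing the quotient also contains [m]. *)
Lemma pommaret_minimal_cover m : U m ->
  exists2 u, pommaret_minimal u & pommaret_cone u m.
Proof.
move: {2}(mdeg m) (leqnn (mdeg m)) => d; elim: d m => [|d IH] m md Um.
  exists m; last by apply/pommaret_coneP; split; first exact: lepm_refl.
  split=> // c _ /negP[]; move: md; rewrite leqn0 mdeg_eq0 => /eqP->.
  by rewrite mnm0E.
have [min_m|] := classic (pommaret_minimal m).
  by exists m => //; apply/pommaret_coneP; split; first exact: lepm_refl.
move=> nmin; have [c [m0 mc Uc]] : exists c : 'I_n,
    [/\ forall l : 'I_n, (l < c)%N -> m l = 0%N, m c != 0%N & U (m - U_(c))%MM].
  apply: NNPP => none; apply: nmin; split=> // c m0 mc Uc.
  by apply: none; exists c.
have le : (U_(c) <= m)%MM by rewrite lep1mP.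
have [|//|u min_u /pommaret_coneP[um mu]] := IH (m - U_(c))%MM.
  by have := congr1 (@mdeg n) (submK le); rewrite mdegD mdeg1; lia.
exists u => //; apply/pommaret_coneP; split.
  exact: lepm_trans um (lem_subr _ _).
move=> i j ij ui; rewrite -(mu i j ij ui) mnmBE mnm1E.
case: eqP => [cj|_]; last by rewrite subn0.
have /mnm_lepP/(_ i) := um; rewrite mnmBE m0 ?cj // sub0n leqn0.
by rewrite (negPf ui).
Qed.

(** At the last index [j] where they differ let [u j] be smaller. Then [u] vanishes before [j],
    otherwise [m j] = [u j] would be less than [v j]. Hence [u] divides [v] over its first variable,
    against the minimality of [v]. *)
Lemma pommaret_minimal_disjoint u v m :
  pommaret_minimal u -> pommaret_minimal v ->
  pommaret_cone u m -> pommaret_cone v m -> u = v.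
Proof.
move=> + + /pommaret_coneP[+ +] /pommaret_coneP[+ +].
move=> Mu Mv um mu vm mv; apply/eqP; apply: contraT => uv.
have [j0 neq0] : exists j, u j != v j.
  apply/existsP; apply: contraNT uv => /existsPn h.
  by apply/eqP/mnmP => j; have := h j; rewrite negbK => /eqP.
case: (arg_maxnP (fun c : 'I_n => c : nat) (P := fun c => u c != v c) neq0).
move=> j neq max_j {j0 neq0}.
wlog lt : u v Mu Mv um mu vm mv uv neq max_j / (u j < v j)%N => [th|].
  move: (neq); rewrite neq_ltn => /orP[lt|lt].
    exact: (th u v).
  apply: (th v u) => //; try by rewrite eq_sym.
  by move=> l; rewrite eq_sym; apply: max_j.
have u0 (i : 'I_n) : (i < j)%N -> u i = 0%N.
  move=> ij; apply/eqP; apply: contraTT lt => ui.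
  by rewrite -leqNgt -(mu i j ij ui); apply/mnm_lepP.
have vj : v j != 0%N by rewrite -lt0n (leq_trans _ lt).
have [c [vc cj v0]] := first_nonzero vj.
have [_ /(_ c v0 vc)[]] := Mv; case: Mu => Uu _.
apply: (U_up Uu); apply/mnm_lepP => l; rewrite mnmBE mnm1E.
have [lj|jl|lj] := ltngtP l j.
- by rewrite u0.
- have -> : (c == l) = false by apply/eqP => cl; move: cj; rewrite cl leqNgt jl.
  rewrite subn0; have [->//|/max_j] := eqVneq (u l) (v l).
  by move=> lj; have : (l <= j)%N by []; rewrite leqNgt jl.
- have -> : l = j by apply: val_inj.
  by case: (c == j); rewrite ?subn0 /=; lia.
Qed.

Lemma pommaret_decomposition :
  exists L : seq 'X_{1..n}, [/\ uniq L,
    forall m, U m <-> exists2 u, u \in L & pommaret_cone u m &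
    forall u v m, u \in L -> v \in L ->
      pommaret_cone u m -> pommaret_cone v m -> u = v].
Proof.
have [D bD] := pommaret_minimal_bounded.
pose box := [seq [multinom (f i : nat) | i < n] 
  | f : {ffun 'I_n -> 'I_D.+1} <- enum {ffun 'I_n -> 'I_D.+1}].
have [L uL LP] := seq_subset_exists box pommaret_minimal.
have minL u : pommaret_minimal u -> u \in L.
  move=> min_u; apply/LP; split=> //; apply/mapP.
  exists [ffun i => inord (u i)]; first by rewrite mem_enum.
  by apply/mnmP => i; rewrite mnmE ffunE inordK // ltnS bD.
exists L; split=> // [m|u v m /LP[_ Mu] /LP[_ Mv]]; last first.
  exact: pommaret_minimal_disjoint.
split=> [/pommaret_minimal_cover[u /minL uin um]|[u /LP[_ [Uu _]] /pommaret_coneP[um _]]].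
  by exists u.
exact: U_up um.
Qed.

End PommaretDecomposition.

(** * From leading exponents to Pommaret bases, and ideals as spans *)

Lemma pommaret_basis_exists (n : nat) (prec : rel 'X_{1..n}) (R : fieldType)
    (J : {mpoly R[n]} -> Prop) :
  (forall u v, lexpo_set prec J u -> (u <= v)%MM -> lexpo_set prec J v) ->
  (forall m (i j : 'I_n), (i < j)%N -> lexpo_set prec J m ->
    lexpo_set prec J (mnm_move i j m)) ->
  exists H, pommaret_basis prec J H.
Proof.
move=> up mv; have [L [uL LP Ldisj]] := pommaret_decomposition up mv.
have LU u : u \in L -> lexpo_set prec J u.
  move=> uL'; apply/LP; exists u => //.
  by apply/pommaret_coneP; split; first exact: lepm_refl.
have [H [HJ HL LH Hinj]] : exists H : seq {mpoly R[n]},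
    [/\ forall h, h \in H -> J h /\ h != 0,
        forall h, h \in H -> lexpo prec h \in L,
        forall u, u \in L -> exists2 h, h \in H & lexpo prec h = u &
        {in H &, injective (lexpo prec (R := R))}].
  elim: L uL LU {LP Ldisj} => [|u L IH] /=; first by exists [::].
  move=> /andP[uL uniqL] LU.
  have [|H [HJ HL LH Hinj]] := IH uniqL.
    by move=> v vL; apply: LU; rewrite in_cons vL orbT.
  have [f [Jf f0 fu]] := LU u (mem_head _ _).
  exists (f :: H); split.
  - by move=> h; rewrite in_cons => /orP[/eqP->|/HJ].
  - move=> h; rewrite !in_cons => /orP[/eqP->|/HL->]; last by rewrite orbT.
    by rewrite fu eqxx.
  - move=> v; rewrite in_cons => /orP[/eqP->|/LH[h hH <-]].
      by exists f => //; apply: mem_head.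
    by exists h => //; rewrite in_cons hH orbT.
  - move=> h1 h2; rewrite !in_cons => /orP[/eqP->|h1H] /orP[/eqP->|h2H] //.
    + by rewrite fu => e; move: uL; rewrite e HL.
    + by rewrite fu => e; move: uL; rewrite -e HL.
    + exact: Hinj.
exists H; split=> // [m|h1 h2 m h1H h2H c1 c2].
  rewrite LP; split=> [[u /LH[h hH <-] um]|[h hH hm]]; first by exists h.
  by exists (lexpo prec h) => //; apply: HL.
apply: Hinj => //.
by apply: (Ldisj _ _ m) => //; apply: HL.
Qed.

Lemma span_lead_move (k : comNzRingType) (n : nat) (prec : rel 'X_{1..n})
    (I : {mpoly k[n]} -> Prop) (R : idomainType) (iota : {rmorphism k -> R})
    (X : 'M[R]_n) (i j : 'I_n) m :
  monomial_order prec -> is_generic iota X -> prec U_(i)%MM U_(j)%MM -> i != j ->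
  span_lead prec I iota X m -> span_lead prec I iota X (mnm_move i j m).
Proof.
move=> ord genX ij neq [g [s sI gE] gm].
have tnth_s (l : 'I_(size s)) : I (tnth (in_tuple s) l).2 by apply/sI/mem_tnth.
have [|c cm] := generic_lead_move ord ij neq genX (q := size s)
    (f := fun l => (tnth (in_tuple s) l).2) (m := m).
  by exists (fun l => (tnth (in_tuple s) l).1); rewrite gE big_tnth in gm.
exists (\sum_l c l *: subst iota X (tnth (in_tuple s) l).2) => //.
by apply: span_sum => l _; apply/spanZ/span_subst.
Qed.

Lemma generic_specialization (k : fieldType) (n : nat) (prec : rel 'X_{1..n})
    (I : {mpoly k[n]} -> Prop) :
  term_order prec -> increasing_vars prec -> is_ideal I ->
  exists (N : nat) (U : 'X_{1..n} -> Prop),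
  [/\ forall u v, U u -> (u <= v)%MM -> U v,
      forall m (i j : 'I_n), (i < j)%N -> U m -> U (mnm_move i j m) &
      forall (K : fieldType) (phi : {rmorphism k -> K}), has_at_least N K ->
        exists2 A : 'M[K]_n, A \in unitmx &
          forall m, span_lead prec I phi (invmx A) m <-> U m].
Proof.
move=> to vars idealI; have ord := term_order_monomial to.
have genX := @generic_mx_generic k n.
set iota := (X in is_generic X _) in genX; set X := generic_mx k n in genX.
have detX := generic_det_neq0 genX.
pose U := span_lead prec I iota X; have [s sU sP] := dickson U.
have [P P0 PP] := common_lead_coef sU.
(* A field with this many elements has a point where neither [\det X] nor [P] vanishes. *)
exists (msize (\det X * P)), U; split.
- by move=> u v; apply: (span_lead_dvd to idealI detX).
- move=> m i j ij; apply: (span_lead_move ord genX); first exact: vars.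
  by rewrite -val_eqE neq_ltn ij.
move=> K phi KN.
have [v v0] := mmap_nonvanishing phi (mulf_neq0 detX P0) KN.
pose psi : {rmorphism {mpoly k[n * n]} -> K} := mmap phi v.
have psiC c : psi (iota c) = phi c by exact: mmapC.
have psi0 : psi (\det X * P) != 0 by exact: v0.
move: psi0; rewrite rmorphM mulf_eq0 negb_or => /andP[psidet psiP].
(* [change_vars] substitutes by the inverse of its matrix, hence the inverse here. *)
exists (invmx (map_mx psi X)).
  by rewrite unitmx_inv unitmxE unitfE det_map_mx.
move=> m; rewrite invmxK.
exact: (span_lead_specialize to idealI psiC detX PP sP psiP psidet).
Qed.

(** A common form for I itself, with [phi] the identity, and for the ideal it generates over an
    extension field. *)
Definition scalar_span (k K : fieldType) (n : nat) (phi : {rmorphism k -> K})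
    (I : {mpoly k[n]} -> Prop) (g : {mpoly K[n]}) : Prop :=
  exists2 s : seq (K * {mpoly k[n]}), (forall x, x \in s -> I x.2) &
    g = \sum_(x <- s) x.1 *: map_mpoly phi x.2.

Lemma change_vars_span_lead (k K : fieldType) (n : nat) (prec : rel 'X_{1..n})
    (phi : {rmorphism k -> K}) (I : {mpoly k[n]} -> Prop)
    (J : {mpoly K[n]} -> Prop) (A : 'M[K]_n) m :
  term_order prec -> (forall g, J g <-> scalar_span phi I g) ->
  lexpo_set prec (change_vars_ideal A J) m <-> span_lead prec I phi (invmx A) m.
Proof.
move=> to JI; rewrite (lexpo_setP to); split.
  move=> [_ [g /JI[s sI ->] ->] gm]; rewrite change_varsE in gm.
  exists (lin_sub (invmx A) (\sum_(x <- s) x.1 *: map_mpoly phi x.2)) => //.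
  exists s => //; rewrite raddf_sum; apply: eq_bigr => x _ /=.
  by rewrite lin_subZ.
move=> [g [s sI ->] gm]; exists (\sum_(x <- s) x.1 *: subst phi (invmx A) x.2) => //.
exists (\sum_(x <- s) x.1 *: map_mpoly phi x.2); first by apply/JI; exists s.
rewrite change_varsE raddf_sum; apply: eq_bigr => x _ /=.
by rewrite lin_subZ.
Qed.

Lemma scalar_span_id (k : fieldType) (n : nat) (I : {mpoly k[n]} -> Prop) g :
  is_ideal I -> I g <-> scalar_span idfun I g.
Proof.
move=> [I0 ID IM]; split=> [Ig|[s sI ->]].
  exists [:: (1, g)] => [x|]; first by rewrite inE => /eqP->.
  by rewrite big_seq1 scale1r map_mpolyK.
elim: s sI => [|x s IH] sI; first by rewrite big_nil.
rewrite big_cons map_mpolyK; apply: ID.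
  by rewrite -mul_mpolyC; apply: IM; apply: sI; apply: mem_head.
by apply: IH => y ys; apply: sI; rewrite in_cons ys orbT.
Qed.

(** The span is already an ideal, because monomials over [K] come from monomials over [k]. *)
Lemma extend_ideal_span (k : fieldType) (K : fieldExtType k) (n : nat)
    (I : {mpoly k[n]} -> Prop) g :
  is_ideal I -> extend_ideal (K := K) I g <-> scalar_span (in_alg K) I g.
Proof.
move=> [I0 ID IM]; split=> [|[s sI ->] J [J0 JD JM] IJ].
  apply=> [|f If]; last first.
    exists [:: (1, f)] => [x|]; first by rewrite inE => /eqP->.
    by rewrite big_seq1 scale1r.
  split.
  - by exists [::] => //; rewrite big_nil.
  - move=> _ _ [s sI ->] [t tI ->]; exists (s ++ t) => [x|]; last by rewrite big_cat.
    by rewrite mem_cat => /orP[/sI|/tI].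
  - move=> f _ [s sI ->].
    exists [seq (f@_m * x.1, 'X_[m] * x.2) | m <- msupp f, x <- s].
      by move=> _ /allpairsP[[m x] [_ /sI Ix ->]]; apply: IM.
    rewrite big_allpairs_dep {1}(mpolyE f) mulr_suml; apply: eq_bigr => m _.
    rewrite mulr_sumr; apply: eq_bigr => x _ /=.
    by rewrite rmorphM /= map_mpolyX -scalerAl -scalerAr scalerA.
elim: s sI => [|x s IH] sI; first by rewrite big_nil.
rewrite big_cons; apply: JD.
  by rewrite -mul_mpolyC; apply: JM; apply: IJ; apply: sI; apply: mem_head.
by apply: IH => y ys; apply: sI; rewrite in_cons ys orbT.
Qed.

(** * Sizes of fields and extensions of finite fields *)

Lemma not_finite_has_at_least (k : fieldType) N :
  ~ finite_field k -> has_at_least N k.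
Proof.
move=> nfin; elim: N => [|N [s us sN]]; first by exists [::].
have [[x xs]|none] := classic (exists x, x \notin s).
  by exists (x :: s); rewrite /= ?xs.
case: nfin; exists s => x; apply/negPn/negP => xs.
by apply: none; exists x.
Qed.

(** An equality of structures, so that extensions of [F] are extensions of [k] itself. *)
Lemma finite_field_finFieldType (k : fieldType) :
  finite_field k -> exists F : finFieldType, F = k :> fieldType.
Proof.
(* Only for a [k] in constructor form is the packed finFieldType convertible
   to [k]. *)
case: k => T c [s sk]; destruct c; set k := GRing.Field.Pack _ in s sk *.
have pick_s : pcancel (fun x => index x s) (fun i => nth None [seq Some x | x <- s] i).
  by move=> x; rewrite (nth_map x) ?index_mem // nth_index.
pose cm := PCanIsCountable pick_s.
have ax : Finite.axiom (undup s).
  by apply: Finite.uniq_enumP; [apply: undup_uniq|move=> x; rewrite mem_undup sk].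
pose F : finFieldType := HB.pack (k : Type) k cm (isFinite.Build k ax).
by exists F.
Qed.

(* Adjoin the roots of unity of a large order prime to the characteristic. *)
Lemma finite_field_extension (k : fieldType) N :
  finite_field k -> exists K : fieldExtType k, has_at_least N K.
Proof.
move=> /finite_field_finFieldType[F <-].
(* Two consecutive integers cannot both vanish in [F], so [N.+1] or [N.+2] is prime to the
   characteristic. *)
have [M [NM M0]] : exists M, (N <= M)%N /\ M.+1%:R != 0 :> F.
  have [N0|N0] := eqVneq (N.+1%:R : F) 0; last by exists N.
  by exists N.+1; split=> //; rewrite -natr1 N0 add0r oner_neq0.
have p0 : 'X^(M.+1) - 1 != 0 :> {poly F} by rewrite monic_neq0 // monicXnsubC.
have [L [zs pL _]] := FinSplittingFieldFor p0; exists L, zs; last first.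
  have := eqp_size pL; rewrite size_prod_XsubC rmorphB rmorphXn /= map_polyX rmorph1.
  by rewrite size_XnsubC // => -[<-]; apply: leqW.
(* The roots are distinct because the polynomial is separable. *)
rewrite -separable_prod_XsubC -(eqp_separable pL).
rewrite rmorphB rmorphXn /= map_polyX rmorph1 separable_Xn_sub_1 //.
by rewrite -(rmorph_nat (in_alg L)) fmorph_eq0.
Qed.

Theorem theorem2p15 (k : fieldType) (n : nat) (prec : rel 'X_{1..n})
    (I : {mpoly k[n]} -> Prop)
    (prec_to : term_order prec)
    (prec_vars : increasing_vars prec)
    (I_ideal : is_ideal I) :
  (~ finite_field k -> pommaret_in_suitable_vars prec I) /\
  (finite_field k ->
     exists N : nat,
       [/\ has_at_least N k -> pommaret_in_suitable_vars prec I,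
           exists K : fieldExtType k, has_at_least N K
         & forall K : fieldExtType k, has_at_least N K ->
             pommaret_in_suitable_vars prec (extend_ideal (K := K) I)]).
Proof.
have [N [U [U_up U_move spec]]] :=
  generic_specialization prec_to prec_vars I_ideal.
(* One argument for [k] and all its extensions: [N] and [U] were fixed before the field [K]. *)
have basis (K : fieldType) (phi : {rmorphism k -> K}) (J : {mpoly K[n]} -> Prop) :
    (forall g, J g <-> scalar_span phi I g) -> has_at_least N K ->
    pommaret_in_suitable_vars prec J.
  move=> JI /(spec K phi)[A Aunit AU]; exists A => //.
  have leU m : lexpo_set prec (change_vars_ideal A J) m <-> U m.
    by rewrite (change_vars_span_lead A m prec_to JI).
  apply: pommaret_basis_exists => [u v|m i j ij] /leU Um.
    by move=> uv; apply/leU; apply: U_up uv.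
  by apply/leU; apply: U_move.
have basis_k : has_at_least N k -> pommaret_in_suitable_vars prec I.
  by apply: (basis k idfun) => g; apply: scalar_span_id.
split=> [/(not_finite_has_at_least N)//|k_fin]; exists N; split=> // [|K].
  exact: finite_field_extension.
by apply: (basis K (in_alg K)) => g; apply: extend_ideal_span.
Qed.
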